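(* Let $(\mathcal{X},Q,\pi)$ be a Markov triple, let $\Lambda$ be an admissible mean, and let $\mathcal{W}$ be the associated discrete transport distance on $\mathcal{P}(\mathcal{X})$. Let $\mathcal{Y}$ be a subset of $\mathcal{X}$ with the retraction property. For all $\mu^0,\mu^1\in\mathcal{P}(\mathcal{X})$ with support in $\mathcal{Y}$ there exists a minimising $\mathcal{W}$-geodesic $(\mu_t)_{t\in[0,1]}\subseteq\mathcal{P}(\mathcal{X})$ connecting $\mu^0$ and $\mu^1$ such that $\mu_t$ has support in $\mathcal{Y}$ for all $t\in[0,1]$.
   Context: Markov triple: $\mathcal{X}$ is a finite set; $Q:\mathcal{X}\times\mathcal{X}\to\mathbb{R}_+=[0,\infty)$ are transition rates with $Q(x,x)=0$; $Q$ is irreducible (any $x,y\in\mathcal{X}$ are connected by a path $x=x_0,\dots,x_n=y$ with $Q(x_{i-1},x_i)>0$); $\pi$ is the unique (strictly positive) stationary probability measure; and $Q$ is reversible: $\pi(x)Q(x,y)=\pi(y)Q(y,x)$ for all $x,y$. $\mathcal{P}(\mathcal{X})$ is the set of probability measures on $\mathcal{X}$. Admissible mean: a continuous function $\Lambda:\mathbb{R}_+\times\mathbb{R}_+\to\mathbb{R}_+$ that is $C^\infty$ on $(0,\infty)^2$, symmetric, positively $1$-homogeneous, non-decreasing in each variable, jointly concave, with $\Lambda(1,1)=1$. Action: let $A:\mathbb{R}^3\to[0,\infty]$, $A(s,t,w)=w^2/\Lambda(s,t)$ if $w\in\mathbb{R}$ and $s,t>0$; $A(s,t,w)=0$ if $w=0$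 and $s,t\ge0$; $A(s,t,w)=+\infty$ otherwise. For $\mu\in\mathcal{P}(\mathcal{X})$, $V:\mathcal{X}\times\mathcal{X}\to\mathbb{R}$ put $\mathcal{A}(\mu,V)=\frac12\sum_{x,y\in\mathcal{X}}A(\mu(x)Q(x,y),\mu(y)Q(y,x),V(x,y))$. Continuity equation: $\mathsf{CE}_1(\mu_0,\mu_1)$ is the set of pairs $(\mu,V)$ with $\mu:[0,1]\to\mathcal{P}(\mathcal{X})$ continuous, $V:[0,1]\to\mathbb{R}^{\mathcal{X}\times\mathcal{X}}$ locally integrable, $\mu|_{t=0}=\mu_0$, $\mu|_{t=1}=\mu_1$, and, in the sense of distributions, $\frac{d}{dt}\mu_t(x)+\frac12\sum_{y\in\mathcal{X}}(V_t(x,y)-V_t(y,x))=0$ for all $x\in\mathcal{X}$. Discrete transport distance: $\mathcal{W}(\mu_0,\mu_1)=\inf\big\{\sqrt{\int_0^1\mathcal{A}(\mu_t,V_t)\,dt}:(\mu,V)\in\mathsf{CE}_1(\mu_0,\mu_1)\big\}$. A (minimising) $\mathcal{W}$-geodesic is a constant speed geodesic in $(\mathcal{P}(\mathcal{X}),\mathcal{W})$: a curve $(\mu_t)_{t\in[0,1]}$ in $\mathcal{P}(\mathcal{X})$ with $\mathcal{W}(\mu_s,\mu_t)=|t-s|\,\mathcal{W}(\mu_0,\mu_1)$ for all $s,t\in[0,1]$. Retraction property: $\mathcal{Y}\subseteq\mathcal{X}$ is connected if any two distinct points of $\mathcal{Y}$ can be joined by a path $y_0,\dots,y_n$ in $\mathcal{Y}$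 with $Q(y_{i-1},y_i)>0$ for all $i$. A connected subset $\mathcal{Y}\subseteq\mathcal{X}$ has the retraction property if there is a map $T:\mathcal{X}\to\mathcal{Y}$ (a retraction) such that $T(y)=y$ for all $y\in\mathcal{Y}$, and for all $y,y'\in\mathcal{Y}$ with $y\ne y'$ and all $x\in T^{-1}(y)$, $\sum_{x'\in T^{-1}(y')}Q(x,x')\le Q(y,y')$. *)

(* Defs.v *)
From HB Require Import structures.
From mathcomp Require Import all_boot all_order all_algebra.
From mathcomp Require Import all_classical all_reals all_analysis.

Set Implicit Arguments.
Unset Strict Implicit.
Unset Printing Implicit Defensive.

Import Order.TTheory GRing.Theory Num.Theory.
Import numFieldNormedType.Exports.

Local Open Scope classical_set_scope.
Local Open Scope ring_scope.

(** Probability measures on a finite set, given by their mass functions. *)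
Definition prob (R : realType) (X : finType) (m : X -> R) : Prop :=
  (forall x, 0 <= m x) /\ \sum_x m x = 1.

Definition stationary (R : realType) (X : finType) (Q : X -> X -> R)
    (m : X -> R) : Prop :=
  forall y, \sum_x m x * Q x y = m y * \sum_x Q y x.

Record markov_triple (R : realType) (X : finType) (Q : X -> X -> R)
    (p : X -> R) : Prop := MarkovTriple {
  rate_ge0 : forall x y, 0 <= Q x y;
  rate_diag : forall x, Q x x = 0;
  rate_irreducible : forall x y, connect [rel u v | 0 < Q u v] x y;
  stat_prob : prob p;
  stat_gt0 : forall x, 0 < p x;
  stat_stationary : stationary Q p;
  stat_unique : forall q, prob q -> stationary Q q -> q = p;
  stat_reversible : forall x y, p x * Q x y = p y * Q y x }.

Definition quadrant (R : realType) : set (R * R) :=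
  [set u | 0 <= u.1 /\ 0 <= u.2].

Definition open_quadrant (R : realType) : set (R * R) :=
  [set u | 0 < u.1 /\ 0 < u.2].

(** [Ck n D f]: on the open set [D], all iterated partial derivatives of [f] up
    to order [n] exist and are continuous. *)
Fixpoint Ck (R : realType) (n : nat) (D : set (R * R)) (f : R * R -> R) : Prop :=
  (forall u, D u -> {for u, continuous f}) /\
  match n with
  | 0 => True
  | n'.+1 =>
      [/\ forall u, D u -> derivable f u (1, 0) /\ derivable f u (0, 1),
          Ck n' D ('D_(1, 0) f)
        & Ck n' D ('D_(0, 1) f)]
  end.

(** A mean is a function on the closed quadrant; its values elsewhere are
    unconstrained and never used. *)
Record admissible_mean (R : realType) (L : R * R -> R) : Prop := AdmissibleMean {
  mean_ge0 : forall s t, 0 <= s -> 0 <= t -> 0 <= L (s, t);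
  mean_continuous : {within @quadrant R, continuous L};
  mean_smooth : forall n, Ck n (@open_quadrant R) L;
  mean_sym : forall s t, 0 <= s -> 0 <= t -> L (s, t) = L (t, s);
  mean_homogeneous : forall c s t, 0 < c -> 0 <= s -> 0 <= t ->
    L (c * s, c * t) = c * L (s, t);
  mean_monol : forall s s' t, 0 <= s -> s <= s' -> 0 <= t ->
    L (s, t) <= L (s', t);
  mean_monor : forall s t t', 0 <= s -> 0 <= t -> t <= t' ->
    L (s, t) <= L (s, t');
  mean_concave : forall c s t s' t', 0 <= c <= 1 ->
    0 <= s -> 0 <= t -> 0 <= s' -> 0 <= t' ->
    c * L (s, t) + (1 - c) * L (s', t')
      <= L (c * s + (1 - c) * s', c * t + (1 - c) * t');
  mean_one : L (1, 1) = 1 }.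

Definition action_density (R : realType) (L : R * R -> R) (s t w : R) : \bar R :=
  if (0 < s) && (0 < t) then (w ^+ 2 / L (s, t))%:E
  else if [&& w == 0, 0 <= s & 0 <= t] then 0%E
  else +oo%E.

Definition action (R : realType) (X : finType) (Q : X -> X -> R)
    (L : R * R -> R) (m : X -> R) (v : X -> X -> R) : \bar R :=
  (2^-1%:E * \sum_x \sum_y
     action_density L (m x * Q x y)%R (m y * Q y x)%R (v x y))%E.

(** C^oo functions with compact support in the open interval (0, 1). *)
Definition test_function (R : realType) (phi : R -> R) : Prop :=
  (forall n t, derivable (derive1n n phi) t 1) /\
  (exists a b : R, [/\ 0 < a, b < 1 & forall t, t \notin `[a, b] -> phi t = 0]).

(** The library's [locally_integrable] is restricted to open domains, whence
    this version. *)
Definition loc_integrable (R : realType) (D : set R) (f : R -> R) : Prop :=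
  forall K : set R, K `<=` D -> compact K ->
    (@lebesgue_measure R).-integrable K (EFin \o f).

(** Curves are functions on the whole line, of which only the restriction to
    [0, 1] matters. *)
Record CE1 (R : realType) (X : finType) (m0 m1 : X -> R)
    (m : R -> X -> R) (V : R -> X -> X -> R) : Prop := ContinuityEq {
  ce_prob : forall t, 0 <= t <= 1 -> prob (m t);
  ce_continuous : forall x, {within `[0, 1], continuous (fun t => m t x)};
  ce_integrable : forall x y, loc_integrable `[0, 1] (fun t => V t x y);
  ce_start : m 0 = m0;
  ce_end : m 1 = m1;
  ce_weak : forall x (phi : R -> R), test_function phi ->
    - (\int[@lebesgue_measure R]_(t in `[0, 1]) (derive1 phi t * m t x))%R
    + (\int[@lebesgue_measure R]_(t in `[0, 1])
         (phi t * (2^-1 * \sum_y (V t x y - V t y x))))%R = 0 }.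

Definition transport_dist (R : realType) (X : finType) (Q : X -> X -> R)
    (L : R * R -> R) (m0 m1 : X -> R) : \bar R :=
  ereal_inf [set z | exists m V, CE1 m0 m1 m V /\
    z = sqrte (\int[@lebesgue_measure R]_(t in `[0%R, 1%R])
                 action Q L (m t) (V t))%E].

Definition geodesic (R : realType) (X : finType) (Q : X -> X -> R)
    (L : R * R -> R) (m : R -> X -> R) : Prop :=
  (forall t, 0 <= t <= 1 -> prob (m t)) /\
  (forall s t, 0 <= s <= 1 -> 0 <= t <= 1 ->
     transport_dist Q L (m s) (m t)
     = (`|t - s|%:E * transport_dist Q L (m 0%R) (m 1%R))%E).

Definition connected_subset (R : realType) (X : finType) (Q : X -> X -> R)
    (Y : {set X}) : Prop :=
  {in Y &, forall y y', y != y' ->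
     connect [rel u v | [&& u \in Y, v \in Y & 0 < Q u v]] y y'}.

Definition retraction (R : realType) (X : finType) (Q : X -> X -> R)
    (Y : {set X}) (T : X -> X) : Prop :=
  [/\ forall x, T x \in Y,
      {in Y, forall y, T y = y}
    & {in Y &, forall y y', y != y' -> forall x, T x = y ->
         \sum_(x' | T x' == y') Q x x' <= Q y y'}].

Definition retraction_property (R : realType) (X : finType) (Q : X -> X -> R)
    (Y : {set X}) : Prop :=
  connected_subset Q Y /\ exists T : X -> X, retraction Q Y T.

(* Main.v *)
Require Import Defs.
From HB Require Import structures.
From mathcomp Require Import all_boot all_order all_algebra.
From mathcomp Require Import all_classical all_reals all_analysis.
From mathcomp Require Import measurable_realfun ring lra.

Set Implicit Arguments.
Unset Strict Implicit.
Unset Printing Implicit Defensive.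

Import Order.TTheory GRing.Theory Num.Theory.
Import numFieldNormedType.Exports.

Local Open Scope classical_set_scope.
Local Open Scope ring_scope.

(** Write [W] for the transport distance. The proof has two independent halves:
    any two probability measures are joined by a [W]-geodesic, and the
    push-forward by the retraction [T] does not increase [W]. Pushing a geodesic
    between [mu0] and [mu1] forward by [T] gives a curve carried by [Y] with the
    same endpoints, along which [W] grows at most linearly at the speed
    [W mu0 mu1]; the triangle inequality turns this into a constant speed.

    Existence of geodesics. The action density is infinite as soon as a flux
    meets a vertex without mass, even when [L (s, 0) > 0], so that it is not
    lower semicontinuous in general (for the arithmetic mean, say) and an
    optimal curve for the action need not exist. A geodesic only has to realise
    distances, and for that metric facts suffice:
    - [W] is symmetric and satisfies the triangle inequality, and for a curve
      [m] of finite action the Cauchy-Schwarz bound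
      [W (m s) (m t) ^+ 2 <= (t - s) * (action spent on [s, t])] holds
      ([dist_subcurve]);
    - [W nu0 nu1 <= sqrt (C * d)] whenever [nu0] and [nu1] are [d]-close
      ([transport_dist_holder]); in particular [W] is finite and continuous for
      the Euclidean topology. This comes from an explicit curve that moves
      linearly from [nu0] to [nu1] while making a detour of size [d] towards the
      stationary measure, which keeps all masses positive in between.
    Let now [m n] be curves from [mu0] to [mu1] of action less than
    [(w + n.+1%:R^-1) ^+ 2], where [w = W mu0 mu1], and let [gamma t] be the limit
    of the [m n t] along a fixed free ultrafilter. For [s <= t] the distances
    [a], [b], [c] between [gamma 0], [gamma s], [gamma t], [gamma 1] satisfy
    [a ^+ 2 / s + b ^+ 2 / (t - s) + c ^+ 2 / (1 - t) <= w ^+ 2] and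
    [w <= a + b + c], which is the equality case of Cauchy-Schwarz and forces
    [b = (t - s) * w] ([split_energy_equality], [short_curve_exists]).

    Triangle inequality. Two curves are glued at a time [tau], and optimising
    [tau] turns the sum of the energies [E / tau + E' / (1 - tau)] into the
    square of [sqrt E + sqrt E']. That the glued curve solves the continuity
    equation is not formal, since a test function on [(0, 1)] need not vanish at
    [tau]: the weak equation has to be extended to all smooth functions, with
    boundary terms ([weak_boundary]), by means of smooth cutoffs.

    Contraction. The action density is subadditive in its three arguments jointly
    and decreases with the masses. Summing the flux over the fibres of [T]
    therefore does not increase the action, because the retraction inequality
    bounds the mass flow between two fibres by the one between their base points
    ([action_push]). *)

(** * Smooth functions on the line and a smooth step *)

(** Existence of the first [n.+1] derivatives, by recursion on the derivative
    rather than through iterated derivatives: closure under products and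
    compositions is then a plain induction. *)
Fixpoint smooth_upto (R : realType) (n : nat) (f : R -> R) : Prop :=
  (forall t, derivable f t 1) /\
  if n is k.+1 then smooth_upto k (derive1 f) else True.

Definition smooth (R : realType) (f : R -> R) : Prop :=
  forall n, smooth_upto n f.

(** The family generated by [exp (- 1 / x)] under differentiation. *)
Definition flat (R : realType) (k : nat) (x : R) : R :=
  if 0 < x then x^-1 ^+ k * expR (- x^-1) else 0.

(** Composing twice with [flat 0] produces plateaus on both sides: the inner
    expression is nonpositive for [x <= 0] and constant for [x >= 1]. *)
HB.lock
Definition smooth_step (R : realType) (x : R) : R :=
  flat 0 (flat 0 1 - flat 0 (1 - x)) / flat 0 (flat 0 1).
Arguments smooth_step {R} x.

Section smooth_functions.
Context {R : realType}.
Implicit Types f g : R -> R.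

Lemma smooth_derivable f t : smooth f -> derivable f t 1.
Proof. by move=> /(_ 0%N) [+ _]; apply. Qed.

Lemma smooth_derive f : smooth f -> smooth (derive1 f).
Proof. by move=> sf n; have [_] := sf n.+1. Qed.

Lemma smooth_continuous f : smooth f -> continuous f.
Proof.
move=> sf t; apply: differentiable_continuous.
exact/derivable1_diffP/smooth_derivable.
Qed.

Lemma smoothP f : smooth f <-> forall n t, derivable (derive1n n f) t 1.
Proof.
split=> [sf n|sf n].
  by elim: n f sf => [|n ih] f sf t; [exact: smooth_derivable|
    rewrite derive1Sn; apply/ih/smooth_derive].
elim: n f sf => [|n ih] f sf; split=> //; try exact: (sf 0%N).
by apply: ih => k t; rewrite -derive1Sn.
Qed.

Lemma smooth_uptoW n f : smooth_upto n.+1 f -> smooth_upto n f.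
Proof.
by elim: n f => [f [df _]|n ih f [df sf]]; split; [|exact: I| |exact: ih].
Qed.

Lemma smooth_cst (c : R) : smooth (cst c).
Proof.
move=> n; elim: n c => [|n ih] c; split=> //.
rewrite (_ : derive1 (cst c) = cst 0); first exact: ih.
by apply/funext => t; rewrite derive1_cst.
Qed.

Lemma smooth_uptoD n f g :
  smooth_upto n f -> smooth_upto n g -> smooth_upto n (f \+ g).
Proof.
elim: n f g => [|n ih] f g [df sf] [dg sg].
  by split; [move=> t; exact: derivableD|exact: I].
split=> [t|]; first exact: derivableD.
rewrite (_ : derive1 (f \+ g) = derive1 f \+ derive1 g); first exact: ih.
by apply/funext => t; rewrite /= !derive1E deriveD.
Qed.

Lemma smooth_uptoM n f g :
  smooth_upto n f -> smooth_upto n g -> smooth_upto n (f \* g).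
Proof.
elim: n f g => [|n ih] f g [df sf] [dg sg].
  by split; [move=> t; exact: derivableM|exact: I].
split=> [t|]; first exact: derivableM.
rewrite (_ : derive1 (f \* g) = (f \* derive1 g) \+ (derive1 f \* g)).
  apply: smooth_uptoD; apply: ih => //.
  - by apply: smooth_uptoW; split.
  - by apply: smooth_uptoW; split.
apply/funext => t; rewrite /= !derive1E deriveM//.
by rewrite /GRing.scale/= [g t * _]mulrC.
Qed.

Lemma smooth_upto_comp n f g :
  smooth_upto n f -> smooth_upto n g -> smooth_upto n (f \o g).
Proof.
elim: n f g => [|n ih] f g [df sf] [dg sg].
  split; last exact: I.
  by move=> t; apply/derivable1_diffP/differentiable_comp;
    exact/derivable1_diffP.
split=> [t|].
  apply/derivable1_diffP/differentiable_comp; exact/derivable1_diffP.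
rewrite (_ : derive1 (f \o g) = (derive1 f \o g) \* derive1 g).
  apply: smooth_uptoM => //; apply: ih => //; apply: smooth_uptoW; split=> //.
by apply/funext => t; rewrite /= derive1_comp.
Qed.

Lemma smoothD f g : smooth f -> smooth g -> smooth (f \+ g).
Proof. by move=> sf sg n; exact: smooth_uptoD. Qed.

Lemma smoothM f g : smooth f -> smooth g -> smooth (f \* g).
Proof. by move=> sf sg n; exact: smooth_uptoM. Qed.

Lemma smooth_comp f g : smooth f -> smooth g -> smooth (f \o g).
Proof. by move=> sf sg n; exact: smooth_upto_comp. Qed.

Lemma derive1_affine (a c : R) : derive1 (fun t => a + c * t) = cst c.
Proof.
apply/funext => t; rewrite derive1E deriveD// derive_cst add0r.
by rewrite deriveM// derive_cst derive_id scaler0 addr0 /GRing.scale/= mulr1.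
Qed.

Lemma smooth_affine (a c : R) : smooth (fun t => a + c * t).
Proof.
case=> [|n]; split=> //.
by rewrite derive1_affine; exact: smooth_cst.
Qed.

Lemma smooth_derive1M f g : smooth f -> smooth g ->
  derive1 (f \* g) = (derive1 f \* g) \+ (f \* derive1 g).
Proof.
move=> sf sg; apply/funext => t; rewrite /= !derive1E deriveM;
  [|exact: smooth_derivable..].
by rewrite /GRing.scale/= addrC [g t * _]mulrC.
Qed.

Lemma smooth_derive1D f g : smooth f -> smooth g ->
  derive1 (f \+ g) = derive1 f \+ derive1 g.
Proof.
move=> sf sg; apply/funext => t; rewrite /= !derive1E deriveD//;
  exact: smooth_derivable.
Qed.

Lemma derive1_comp_affine f a c t : smooth f ->
  derive1 (fun s => f (a + c * s)) t = derive1 f (a + c * t) * c.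
Proof.
move=> sf; rewrite (_ : (fun s => _) = f \o (fun s => a + c * s))//.
by rewrite derive1_comp ?derive1_affine//; exact: smooth_derivable.
Qed.

Lemma smooth_comp_affine f a c : smooth f -> smooth (fun s => f (a + c * s)).
Proof.
move=> sf; apply: (@smooth_comp f (fun s => a + c * s)) => //.
exact: smooth_affine.
Qed.

(** Quadratic flatness at the origin follows from the term of order [k.+2] of the
    exponential series at [1 / x]; it makes all the [flat k] differentiable at
    [0] with derivative [0]. *)
Lemma flat_le (k : nat) (x : R) : 0 <= x -> flat k x <= k.+2`!%:R * x ^+ 2.
Proof.
rewrite le_eqVlt => /predU1P[<-|x0].
  by rewrite /flat ltxx expr0n/= mulr0.
rewrite /flat x0.
have y0 : 0 < x^-1 by rewrite invr_gt0.
have := expR_ge1Dxn k.+1 (ltW y0).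
set y := x^-1 in y0 *; move=> hy.
have {}hy : y ^+ k.+2 / k.+2`!%:R <= expR y.
  by apply: le_trans hy; rewrite lerDr.
rewrite expRN.
have f0 : 0 < k.+2`!%:R :> R by rewrite ltr0n fact_gt0.
rewrite ler_pdivrMr ?expR_gt0// -(@ler_pM2l _ (k.+2`!%:R^-1 * y ^+ 2)); last first.
  by rewrite mulr_gt0 ?invr_gt0 ?exprn_gt0.
have -> : k.+2`!%:R^-1 * y ^+ 2 * (k.+2`!%:R * x ^+ 2 * expR y) = expR y.
  by rewrite /y; field; rewrite (gt_eqF f0) (gt_eqF x0).
by apply: le_trans hy; rewrite -mulrA -exprD add2n mulrC.
Qed.

Lemma flat_ge0 k (x : R) : 0 <= flat k x.
Proof.
rewrite /flat; case: ifPn => // x0.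
by rewrite mulr_ge0 ?expR_ge0// exprn_ge0 ?invr_ge0 ?ltW.
Qed.

Lemma flat_gt0 k (x : R) : 0 < x -> flat k x = x^-1 ^+ k * expR (- x^-1).
Proof. by rewrite /flat => ->. Qed.

Lemma flat_le0 k (x : R) : x <= 0 -> flat k x = 0.
Proof. by rewrite /flat ltNge => ->. Qed.

(** The family is closed under differentiation, up to linear combinations, which
    is why its members are smooth. *)
Lemma is_derive_flat k (x : R) :
  is_derive x 1 (flat k) (flat k.+2 x - k%:R * flat k.+1 x).
Proof.
have [x0|x0|->] := ltgtP x 0.
- rewrite !flat_le0 ?ltW// mulr0 subr0.
  apply: (@near_eq_is_derive _ R^o R^o (cst 0)).
  near=> z; rewrite flat_le0// ltW//.
  by near: z; exact: lt_nbhsl.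
- apply: (@near_eq_is_derive _ R^o R^o (fun z : R => z^-1 ^+ k * expR (- z^-1))).
    near=> z; rewrite flat_gt0//.
    by near: z; exact: lt_nbhsr.
  have dV : is_derive x 1 (fun z : R => z^-1) (- x ^- 2).
    have := @is_deriveV _ (@id R) x 1 1 (lt0r_neq0 x0) _.
    by rewrite /GRing.scale/= mulr1; apply.
  have dN : is_derive x 1 (fun z : R => - z^-1) (x ^- 2).
    by have := is_deriveN dV; rewrite opprK.
  have dE := @is_derive1_comp _ expR (fun z : R => - z^-1) x _ _ (is_derive_expR _) dN.
  have dX := @is_deriveX _ _ _ k _ _ _ dV.
  have := is_deriveM dX dE.
  rewrite (_ : (_ * _)%R = (fun z : R => z^-1 ^+ k * expR (- z^-1))); last first.
    apply/funext => z; rewrite /GRing.mul/=; congr (_ * _).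
    by elim: (k) => [|n ih]; rewrite ?expr0// !exprS /GRing.mul/= ih.
  move/is_derive_eq; apply; rewrite !flat_gt0// /GRing.scale/=.
  have -> : (GRing.inv ^+ k : R -> R) x = x^-1 ^+ k.
    by elim: (k) => [|n ih]; rewrite ?expr0// !exprS /GRing.mul/= ih.
  rewrite -exprVn; set y := x^-1; set e := expR _.
  case: (k) => [|n] /=; first by rewrite expr0; ring.
  by rewrite !exprS -natr1; ring.
- rewrite !flat_le0// mulr0 subr0.
  have lim0 : h^-1 *: (flat k (h *: 1 + 0) - flat k 0) @[h --> 0^'] --> (0 : R).
    apply/cvgr0Pnorm_lt => e e0.
    near=> h.
    rewrite addr0 (@flat_le0 _ 0)// subr0 /GRing.scale/= mulr1.
    have [h0|h0] := lerP h 0; first by rewrite flat_le0// mulr0 normr0.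
    rewrite ger0_norm ?mulr_ge0 ?flat_ge0 ?invr_ge0 ?ltW//.
    rewrite ltr_pdivrMl//; apply: le_lt_trans (flat_le k (ltW h0)) _.
    rewrite expr2 mulrCA ltr_pM2l// -ltr_pdivlMl ?ltr0n ?fact_gt0//.
    apply: le_lt_trans (ler_norm _) _.
    by near: h; apply: dnbhs0_lt; rewrite mulr_gt0// invr_gt0 ltr0n fact_gt0.
  apply: DeriveDef; first by apply/cvg_ex; exists 0.
  exact: cvg_lim.
Unshelve. all: by end_near. Qed.

Lemma smooth_flat k : smooth (flat k : R -> R).
Proof.
move=> n; elim: n k => [|n ih] k; (split; last first); try exact: I.
- by move=> t; have := is_derive_flat k t.
- rewrite (_ : derive1 _ = flat k.+2 \+ (cst (- k%:R) \* flat k.+1)).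
    by apply: smooth_uptoD => //; apply: smooth_uptoM => //; exact: smooth_cst.
  apply/funext => t; rewrite derive1E.
  by have := is_derive_flat k t => ?; rewrite derive_val /= mulNr.
- by move=> t; have := is_derive_flat k t.
Qed.

Lemma flat0_mono (x y : R) : x <= y -> flat 0 x <= flat 0 y.
Proof.
move=> xy; have [x0|x0] := lerP x 0; first by rewrite flat_le0// flat_ge0.
have y0 := lt_le_trans x0 xy.
by rewrite !flat_gt0// !expr0 !mul1r ler_expR lerN2 lef_pV2.
Qed.

Lemma smooth_smooth_step : smooth (@smooth_step R).
Proof.
have -> : @smooth_step R = (flat 0 \o (cst (flat 0 1) \+ (cst (-1) \*
    (flat 0 \o (fun x => 1 + (-1) * x))))) \* cst (flat 0 (flat 0 1))^-1.
  by apply/funext => x; rewrite unlock/= !mulN1r.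
apply: smoothM; last exact: smooth_cst.
apply: smooth_comp; first exact: smooth_flat.
apply: smoothD; first exact: smooth_cst.
apply: smoothM; first exact: smooth_cst.
apply: smooth_comp; [exact: smooth_flat|exact: smooth_affine].
Qed.

Lemma smooth_step_le0 (x : R) : x <= 0 -> smooth_step x = 0.
Proof.
move=> x0; rewrite unlock flat_le0 ?mul0r// subr_le0 flat0_mono//; lra.
Qed.

Lemma smooth_step_ge1 (x : R) : 1 <= x -> smooth_step x = 1.
Proof.
move=> x1; rewrite unlock (@flat_le0 _ (1 - x)) ?subr_le0// subr0 divff//.
have p (y : R) : 0 < y -> 0 < flat 0 y.
  by move=> y0; rewrite flat_gt0// expr0 mul1r expR_gt0.
by rewrite lt0r_neq0// !p.
Qed.

Lemma smooth_step_ge0 (x : R) : 0 <= smooth_step x.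
Proof. by rewrite unlock divr_ge0// flat_ge0. Qed.

Lemma smooth_step_le1 (x : R) : smooth_step x <= 1.
Proof.
have [x1|x1] := lerP x 1; last by rewrite smooth_step_ge1// ltW.
rewrite -(smooth_step_ge1 (lexx 1)) unlock ler_pM2r; last first.
  by rewrite invr_gt0 !(flat_gt0, expr0, mul1r, expR_gt0).
by apply: flat0_mono; rewrite lerD2l lerN2 flat0_mono// lerD2l lerN2.
Qed.

Lemma smooth_step_norm_le1 (x : R) : `|smooth_step x| <= 1.
Proof. by rewrite ger0_norm ?smooth_step_ge0 ?smooth_step_le1. Qed.

Lemma derive1_smooth_step_gt1 (x : R) : 1 < x -> derive1 (@smooth_step R) x = 0.
Proof.
move=> x1; rewrite derive1E (@near_eq_derive _ R^o R^o _ (cst 1)) ?derive_cst//.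
by near=> z; rewrite smooth_step_ge1// ltW//; near: z; exact: lt_nbhsr.
Unshelve. all: by end_near. Qed.

Lemma derive1_smooth_step_lt0 (x : R) : x < 0 -> derive1 (@smooth_step R) x = 0.
Proof.
move=> x0; rewrite derive1E (@near_eq_derive _ R^o R^o _ (cst 0)) ?derive_cst//.
by near=> z; rewrite smooth_step_le0// ltW//; near: z; exact: lt_nbhsl.
Unshelve. all: by end_near. Qed.

Lemma derive1_smooth_step_bounded :
  exists2 M : R, 0 <= M & forall x, `|derive1 (@smooth_step R) x| <= M.
Proof.
have cS : {within `[0, 1], continuous (derive1 (@smooth_step R))}.
  apply: continuous_subspaceT; apply: smooth_continuous.
  exact: smooth_derive smooth_smooth_step.
have /compact_bounded[M [_ HM]] := continuous_compact cS (@segment_compact _ 0 1).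
have M1 : M < `|M| + 1 by rewrite ltr_pwDr// ler_norm.
exists (`|M| + 1) => [|x]; first by rewrite addr_ge0.
have [x0|x0] := ltP x 0; first by rewrite derive1_smooth_step_lt0// normr0 addr_ge0.
have [x1|x1] := ltP 1 x; first by rewrite derive1_smooth_step_gt1// normr0 addr_ge0.
by apply: (HM _ M1); exists x => //=; rewrite in_itv/= x0.
Qed.

End smooth_functions.

(** * Affine changes of variable in Lebesgue integrals *)

Section affine_substitution.
Context {R : realType}.
Notation mu := (@lebesgue_measure R).
Variables (a c : R).
Hypothesis c0 : c != 0.

Let ell (t : R) : R := a + c * t.

Let measurable_ell : measurable_fun [set: R] (ell : R -> measurableTypeR R).
Proof.
exact: continuous_measurable_fun (smooth_continuous (smooth_affine a c)).
Qed.

Let normc_ge0 : (0 <= `|c|)%R. Proof. exact: normr_ge0. Qed.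

Let pushed : {measure set (measurableTypeR R) -> \bar R}.
Proof.
by refine (pushforward mu (ell : R -> measurableTypeR R) : {measure set _ -> \bar R}).
Defined.

Let dilated : {measure set (measurableTypeR R) -> \bar R} :=
  mscale (NngNum normc_ge0) pushed.

(** The image of the Lebesgue measure under an affine map, rescaled, agrees with
    the Lebesgue measure on intervals, hence everywhere. *)
Let dilatedE (A : set R) : measurable A -> mu A = dilated A.
Proof.
move=> mA; apply: lebesgue_measure_unique => // _ [[u v] _ <-].
rewrite /dilated /= /mscale/= /pushforward lebesgue_measure_itv/=.
have [cp|cn] : 0 < c \/ c < 0.
  by move: c0; rewrite neq_lt => /orP[]; [right|left].
- rewrite (_ : ell @^-1` _ = `](u - a) / c, (v - a) / c]%classic); last first.
    apply/seteqP; split => t /=; rewrite !in_itv/= /ell ltr_pdivrMr// ler_pdivlMr//.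
      by rewrite ltrBlDl lerBrDl mulrC.
    by rewrite ltrBlDl lerBrDl mulrC.
  rewrite lebesgue_measure_itv/= !lte_fin ltr_pM2r ?invr_gt0// ltrD2r.
  case: ifPn => _; last by rewrite mule0.
  by rewrite -!EFinD -EFinM gtr0_norm//; congr EFin; field.
- rewrite (_ : ell @^-1` _ = `[(v - a) / c, (u - a) / c[%classic); last first.
    apply/seteqP; split => t /=; rewrite !in_itv/= /ell ler_ndivrMr// ltr_ndivlMr//.
      by rewrite ltrBlDl lerBrDl mulrC andbC.
    by rewrite ltrBlDl lerBrDl mulrC andbC.
  rewrite lebesgue_measure_itv/= !lte_fin ltr_nM2r ?invr_lt0// ltrD2r.
  case: ifPn => _; last by rewrite mule0.
  by rewrite -!EFinD -EFinM ltr0_norm//; congr EFin; field; rewrite ?lt_eqF.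
Qed.

Let measurable_pre (D : set (measurableTypeR R)) : measurable D ->
  measurable (ell @^-1` D : set (measurableTypeR R)).
Proof. by move=> mD; rewrite -[_ @^-1` _]setTI; exact: measurable_ell. Qed.

Lemma ge0_integral_affine (D : set R) (f : R -> \bar R) : measurable D ->
  measurable_fun D f -> (forall t, D t -> 0 <= f t)%E ->
  (\int[mu]_(t in D) f t =
   `|c|%:E * \int[mu]_(t in (fun t => a + c * t)%R @^-1` D) f (a + c * t)%R)%E.
Proof.
move=> mD mf f0.
rewrite (@eq_measure_integral _ _ _ _ dilated); last by move=> A mA _; exact: dilatedE.
rewrite ge0_integral_mscale//=; congr (_ * _)%E.
by apply: ge0_integral_pushforward => // y /[!inE]; exact: f0.
Qed.

Lemma integrable_affine (D : set R) (f : R -> R) : measurable D ->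
  mu.-integrable D (EFin \o f) ->
  mu.-integrable ((fun t => a + c * t) @^-1` D) (fun t => (f (a + c * t))%:E).
Proof.
move=> mD /integrableP[mf fi]; apply/integrableP; split.
  apply: (@measurable_comp _ _ _ _ _ _ D (EFin \o f) _ ell) => //.
  - by move=> _ [t Dt <-].
  - by apply: measurable_funTS; exact: measurable_ell.
move: fi; rewrite ge0_integral_affine//; last exact: measurableT_comp.
by case: (integral _ _ _) => [r _|//|]; rewrite ?ltry//
  mulry gtr0_sg ?normr_gt0// mul1e.
Qed.

Lemma Rintegral_affine (D : set R) (f : R -> R) : measurable D ->
  mu.-integrable D (EFin \o f) ->
  \int[mu]_(t in D) f t =
   `|c| * \int[mu]_(t in (fun t => a + c * t)%R @^-1` D) f (a + c * t).
Proof.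
move=> mD fi; have gi := integrable_affine mD fi.
have mDp := measurable_pre mD.
have /measurable_int mf := fi.
have Epos : (\int[mu]_(t in D) (fun t => (f t)%:E)^\+ t = `|c|%:E *
    \int[mu]_(t in (fun t => a + c * t)%R @^-1` D)
      (fun t => (f (a + c * t)%R)%:E)^\+ t)%E.
  rewrite ge0_integral_affine//; last exact: measurable_funepos.
  by congr (_ * _)%E; apply: eq_integral => t _; rewrite ?funeposE ?funenegE.
have Eneg : (\int[mu]_(t in D) (fun t => (f t)%:E)^\- t = `|c|%:E *
    \int[mu]_(t in (fun t => a + c * t)%R @^-1` D)
      (fun t => (f (a + c * t)%R)%:E)^\- t)%E.
  rewrite ge0_integral_affine//; last exact: measurable_funeneg.
  by congr (_ * _)%E; apply: eq_integral => t _; rewrite ?funeposE ?funenegE.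
have p1 := integrable_pos_fin_num mDp gi.
have p2 := integrable_neg_fin_num mDp gi.
have -> : \int[mu]_(t in D) f t =
    fine (\int[mu]_(t in D) (fun t => (f t)%:E)^\+ t -
          \int[mu]_(t in D) (fun t => (f t)%:E)^\- t)%E.
  by rewrite /Rintegral integralE.
have -> : \int[mu]_(t in (fun t => a + c * t)%R @^-1` D) f (a + c * t) =
    fine (\int[mu]_(t in (fun t => a + c * t)%R @^-1` D)
            (fun t => (f (a + c * t)%R)%:E)^\+ t -
          \int[mu]_(t in (fun t => a + c * t)%R @^-1` D)
            (fun t => (f (a + c * t)%R)%:E)^\- t)%E.
  by rewrite /Rintegral integralE.
rewrite Epos Eneg; move: p1 p2.
by move: (integral _ _ _) (integral _ _ _) => [x| |] [y| |]//= _ _; rewrite mulrBr.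
Qed.

End affine_substitution.

(** * The action density *)

Section action_density_theory.
Context {R : realType} (L : R * R -> R).
Hypothesis hL : admissible_mean L.

Lemma mean_ge_min s t m : 0 < m -> m <= s -> m <= t -> m <= L (s, t).
Proof.
move=> m0 ms mt; have mge := ltW m0.
have -> : m = L (m * 1, m * 1).
  by rewrite (mean_homogeneous hL)// (mean_one hL) mulr1.
rewrite mulr1 (le_trans (mean_monol hL mge ms mge))//.
exact: (mean_monor hL (le_trans mge ms) mge mt).
Qed.

Lemma mean_gt0 s t : 0 < s -> 0 < t -> 0 < L (s, t).
Proof.
move=> s0 t0; have m0 : 0 < Num.min s t by rewrite lt_min s0.
by rewrite (lt_le_trans m0)// mean_ge_min// ge_min lexx ?orbT.
Qed.

Lemma mean_le s s' t t' : 0 <= s -> s <= s' -> 0 <= t -> t <= t' ->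
  L (s, t) <= L (s', t').
Proof.
move=> s0 ss' t0 tt'; apply: le_trans (mean_monol hL s0 ss' t0) _.
exact: (mean_monor hL (le_trans s0 ss') t0 tt').
Qed.

(** Concavity at the midpoint, combined with homogeneity. *)
Lemma mean_superadditive s t s' t' : 0 <= s -> 0 <= t -> 0 <= s' -> 0 <= t' ->
  L (s, t) + L (s', t') <= L (s + s', t + t').
Proof.
move=> s0 t0 s'0 t'0.
have h : 0 <= (2^-1 : R) <= 1 by rewrite invr_ge0 ler0n invf_le1 ?ler1n.
have := mean_concave hL h s0 t0 s'0 t'0.
have -> : 1 - 2^-1 = 2^-1 :> R by lra.
by rewrite -!mulrDr (mean_homogeneous hL) ?addr_ge0// ler_pM2l.
Qed.

Local Notation A := (action_density L).

Lemma action_density_ge0 s t w : (0 <= A s t w)%E.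
Proof.
rewrite /action_density; case: ifPn => [/andP[s0 t0]|_].
  by rewrite lee_fin divr_ge0 ?sqr_ge0// ltW// mean_gt0.
by case: ifP.
Qed.

Lemma action_density0 s t : 0 <= s -> 0 <= t -> A s t 0 = 0%E.
Proof.
move=> s0 t0; rewrite /action_density; case: ifP => _.
  by rewrite expr0n/= mul0r.
by rewrite eqxx s0 t0.
Qed.

Lemma action_density_degenerate s t w : ~~ ((0 < s) && (0 < t)) -> w != 0 ->
  A s t w = +oo%E.
Proof. by move=> /negbTE + /negbTE; rewrite /action_density => -> ->. Qed.

Lemma action_density_antitone s s' t t' w :
  0 <= s -> s <= s' -> 0 <= t -> t <= t' -> (A s' t' w <= A s t w)%E.
Proof.
move=> s0 ss' t0 tt'.
have [st|st] := boolP ((0 < s) && (0 < t)); last first.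
  have [->|w0] := eqVneq w 0; last by rewrite [leRHS]action_density_degenerate// leey.
  by rewrite !action_density0 ?(le_trans s0 ss') ?(le_trans t0 tt').
case/andP: (st) => sp tp.
rewrite /action_density st (lt_le_trans sp ss') (lt_le_trans tp tt')/= lee_fin.
rewrite ler_wpM2l ?sqr_ge0// lef_pV2 ?posrE ?mean_gt0//; first exact: mean_le.
  exact: lt_le_trans ss'.
exact: lt_le_trans tt'.
Qed.

Lemma sqr_div_subadditive (w w' l l' : R) : 0 < l -> 0 < l' ->
  (w + w') ^+ 2 / (l + l') <= w ^+ 2 / l + w' ^+ 2 / l'.
Proof.
move=> l0 l'0; rewrite ler_pdivrMr ?addr_gt0// -subr_ge0.
have -> : (w ^+ 2 / l + w' ^+ 2 / l') * (l + l') - (w + w') ^+ 2 =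
    (w * l' - w' * l) ^+ 2 / (l * l').
  by field; rewrite !gt_eqF.
by rewrite divr_ge0 ?sqr_ge0// mulr_ge0// ltW.
Qed.

(** In the interior this is the joint convexity and homogeneity of
    [w ^+ 2 / L (s, t)]. On the boundary only the flux [0] has finite density, and
    a term without flux can be dropped because more mass lowers the density. *)
Lemma action_density_subadditive s t w s' t' w' :
  0 <= s -> 0 <= t -> 0 <= s' -> 0 <= t' ->
  (A (s + s') (t + t') (w + w') <= A s t w + A s' t' w')%E.
Proof.
move=> s0 t0 s'0 t'0.
have [st|st] := boolP ((0 < s) && (0 < t)); last first.
  have [->|w0] := eqVneq w 0; last first.
    rewrite [X in (_ <= X + _)%E]action_density_degenerate//.
    by rewrite addye ?leey// gt_eqF// (lt_le_trans _ (action_density_ge0 _ _ _)).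
  rewrite add0r [X in (_ <= X + _)%E]action_density0// add0e.
  by apply: action_density_antitone; rewrite // lerDr.
have [st'|st'] := boolP ((0 < s') && (0 < t')); last first.
  have [->|w0] := eqVneq w' 0; last first.
    rewrite [X in (_ <= _ + X)%E]action_density_degenerate//.
    by rewrite addey ?leey// gt_eqF// (lt_le_trans _ (action_density_ge0 _ _ _)).
  rewrite addr0 [X in (_ <= _ + X)%E]action_density0// adde0.
  by apply: action_density_antitone; rewrite // lerDl.
case/andP: (st) => sp tp; case/andP: (st') => sp' tp'.
rewrite /action_density st st' !addr_gt0//= -EFinD lee_fin.
apply: le_trans (sqr_div_subadditive _ _ (mean_gt0 sp tp) (mean_gt0 sp' tp')).
rewrite ler_wpM2l ?sqr_ge0// lef_pV2 ?posrE ?mean_gt0 ?addr_gt0 ?mean_gt0//.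
exact: mean_superadditive.
Qed.

Lemma action_density_sum (I : Type) (r : seq I) (P : pred I) (s t w : I -> R) :
  (forall i, P i -> 0 <= s i) -> (forall i, P i -> 0 <= t i) ->
  (A (\sum_(i <- r | P i) s i)%R (\sum_(i <- r | P i) t i)%R
     (\sum_(i <- r | P i) w i)%R
   <= \sum_(i <- r | P i) A (s i) (t i) (w i))%E.
Proof.
move=> s0 t0; elim: r => [|i r ih]; first by rewrite !big_nil action_density0.
rewrite !big_cons; case: ifPn => // Pi.
apply: le_trans (leeD2l _ ih).
by apply: action_density_subadditive; rewrite ?s0 ?t0// sumr_ge0.
Qed.

Lemma action_densityZ c s t w : c != 0 ->
  (A s t (c * w)%R = (c ^+ 2)%:E * A s t w)%E.
Proof.
move=> c0; rewrite /action_density; case: ifP => _.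
  by rewrite -EFinM exprMn -mulrA.
rewrite mulf_eq0 (negbTE c0)/=; case: ifP => _; first by rewrite mule0.
by rewrite mulry gtr0_sg ?mul1e// exprn_even_gt0.
Qed.

(** The density is not continuous, but it is defined by cases on measurable sets:
    a quotient of measurable functions where both masses are positive, and
    constant on each of the remaining sets. *)
Lemma measurable_action_density (D : set R) (a b v : R -> R) :
  measurable D -> {within D, continuous a} -> {within D, continuous b} ->
  (forall t, D t -> 0 <= a t) -> (forall t, D t -> 0 <= b t) ->
  measurable_fun D v ->
  measurable_fun D (fun t => A (a t) (b t) (v t)).
Proof.
move=> mD ca cb a0 b0 mv.
have ma : measurable_fun D a by exact: subspace_continuous_measurable_fun.
have mb : measurable_fun D b by exact: subspace_continuous_measurable_fun.
have mL : measurable_fun D (fun t => L (a t, b t)).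
  apply: subspace_continuous_measurable_fun => //.
  apply/subspace_continuousP => t Dt.
  have /subspace_continuousP/(_ (a t, b t)) := mean_continuous hL.
  move=> /(_ (conj (a0 _ Dt) (b0 _ Dt))); apply: cvg_trans.
  suff cab : (fun z => (a z, b z)) @ within D (nbhs t) `=>`
      within (@quadrant R) (nbhs (a t, b t)) by exact: (cvg_app L cab).
  move=> U [[/= U1 U2] [nU1 nU2] sub].
  move/subspace_continuousP : ca => /(_ _ Dt) /(_ _ nU1) h1.
  move/subspace_continuousP : cb => /(_ _ Dt) /(_ _ nU2) h2.
  have h3 : within D (nbhs t) [set z | U1 (a z) /\ U2 (b z)] by exact: filterI.
  near=> z.
    have Dz : D z by near: z; exact: withinT.
    apply: sub; first by apply: (near h3 z).
    by split; [exact: a0|exact: b0].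
have mge (u : R -> R) : measurable_fun D u -> measurable_fun D (fun t => 0 < u t).
  by move=> mu; apply: measurable_fun_ltr.
have mle (u : R -> R) : measurable_fun D u -> measurable_fun D (fun t => 0 <= u t).
  by move=> mu; apply: measurable_fun_ler.
have mDP (f : R -> bool) b' : measurable_fun D f -> measurable (D `&` f @^-1` [set b']).
  by move=> mf; exact: mf.
rewrite /action_density.
apply: measurable_fun_if => //.
- by apply: measurable_and; exact: mge.
- apply/measurable_EFinP.
  apply: (@eq_measurable_fun _ _ _ _ _ (fun t => v t ^+ 2 * (L (a t, b t)) `^ (-1))).
    (* The inverse is written as a power in order to use its measurability. *)
    move=> t /set_mem [Dt _]; rewrite powR_inv1//.
    by apply: (mean_ge0 hL); [exact: a0|exact: b0].
  apply: measurable_funS mD _ _; first by move=> ? [].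
  apply: measurable_funM; first exact: measurable_funX.
  exact: (measurableT_comp (measurable_powR _)).
- set D' := D `&` _.
  have mD' : measurable D' by apply: mDP; apply: measurable_and; exact: mge.
  have sD : D' `<=` D by move=> ? [].
  apply: measurable_fun_if => //.
  apply: measurable_funS mD sD _.
  apply: measurable_and; first exact: measurable_fun_eqr.
  by apply: measurable_and; exact: mle.
Unshelve. all: by end_near. Qed.

End action_density_theory.

(** * Smooth cutoffs of the unit interval *)

Section interval_integrals.
Context {R : realType}.
Notation mu := (@lebesgue_measure R).
Implicit Types (f g h phi : R -> R) (a b : R).

Lemma integrable_within_continuous a b f : {within `[a, b], continuous f} ->
  mu.-integrable `[a, b] (EFin \o f).
Proof.
by move=> cf; apply: continuous_compact_integrable => //; exact: segment_compact.
Qed.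

Lemma integrable_continuousM a b phi f : continuous phi ->
  mu.-integrable `[a, b] (EFin \o f) ->
  mu.-integrable `[a, b] (EFin \o (fun t => phi t * f t)).
Proof.
move=> cphi fi; have cw : {within `[a, b], continuous phi}.
  exact: continuous_subspaceT.
apply: (@integrableMr _ _ _ mu `[a, b] _ phi (EFin \o f) _ _ fi) => //.
  by apply: measurable_funTS; exact: continuous_measurable_fun.
have /compact_bounded[M [Mr HM]] := continuous_compact cw (@segment_compact _ a b).
exists M; split => // x Mx t abt; apply: HM Mx _ _.
by exists t.
Qed.

Lemma smooth_FTC2 a b f : a < b -> smooth f ->
  \int[mu]_(t in `[a, b]) derive1 f t = f b - f a.
Proof.
move=> ab sf; have cf := smooth_continuous sf.
rewrite /Rintegral (@continuous_FTC2 _ _ f)//.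
- by apply: continuous_subspaceT; exact: smooth_continuous (smooth_derive sf).
- split=> [t _||]; first exact: smooth_derivable.
    by apply: cvg_at_right_filter; exact: cf.
  by apply: cvg_at_left_filter; exact: cf.
Qed.

Lemma Rintegral_vanish (D D' : set R) f : measurable D -> measurable D' ->
  D' `<=` D -> (forall t, D t -> ~ D' t -> f t = 0) ->
  \int[mu]_(t in D) f t = \int[mu]_(t in D') f t.
Proof.
move=> mD mD' D'D f0; rewrite Rintegral_mkcond [RHS]Rintegral_mkcond.
apply: eq_Rintegral => t _; rewrite /patch.
have [tD'|tD'] := boolP (t \in D'); first
  by rewrite ifT// inE; apply: D'D; rewrite -inE.
case: ifPn => // /set_mem tD; apply: f0 => // /mem_set.
by rewrite (negbTE tD').
Qed.

Lemma normr_Rintegral_le a b f k : a <= b -> mu.-integrable `[a, b] (EFin \o f) ->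
  (forall t, a <= t <= b -> `|f t| <= k) ->
  `|\int[mu]_(t in `[a, b]) f t| <= k * (b - a).
Proof.
move=> ab fi fk; apply: le_trans (le_normr_Rintegral _ fi) _ => //.
have -> : k * (b - a) = \int[mu]_(t in `[a, b]) k.
  rewrite Rintegral_cst//= lebesgue_measure_itv/= lte_fin.
  by case: ltgtP ab => // -> _; rewrite subrr.
apply: le_Rintegral => //; first exact: integrable_norm.
  apply: integrable_within_continuous.
  by apply: continuous_subspaceT => ?; exact: cvg_cst.
Qed.

End interval_integrals.

Section cutoff.
Context {R : realType}.
Notation mu := (@lebesgue_measure R).
Implicit Types (f g h phi : R -> R).

(** A smooth function with support in [1 / n.+1, 1 - 1 / n.+1] that equals [1]
    between [2 / n.+1] and [1 - 2 / n.+1]; the argument of the second factor is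
    [n.+1 * (1 - t) - 1], written as an affine function of [t]. *)
Definition cutoff (n : nat) (t : R) : R :=
  smooth_step (-1 + n.+1%:R * t) *
  smooth_step (n.+1%:R - 1 + (- n.+1%:R) * t).

Lemma smooth_cutoff n : smooth (cutoff n).
Proof.
by apply: smoothM; apply: smooth_comp_affine; exact: smooth_smooth_step.
Qed.

Lemma cutoff_eq0 n t : t \notin `[n.+1%:R^-1, 1 - n.+1%:R^-1] -> cutoff n t = 0.
Proof.
have N0 : 0 < n.+1%:R :> R by rewrite ltr0n.
rewrite in_itv/= negb_and -!ltNge => /orP[tl|tr]; rewrite /cutoff.
  rewrite smooth_step_le0 ?mul0r//.
  move: tl; rewrite -(ltr_pM2l N0) divff ?gt_eqF//; lra.
rewrite [X in _ * X]smooth_step_le0 ?mulr0//.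
move: tr; rewrite -(ltr_pM2l N0) mulrBr divff ?gt_eqF//; lra.
Qed.

Lemma cutoff_norm_le1 n t : `|cutoff n t| <= 1.
Proof. by rewrite normrM mulr_ile1// smooth_step_norm_le1. Qed.

Lemma cutoff0 n : cutoff n 0 = 0.
Proof. by rewrite cutoff_eq0// in_itv/= negb_and -ltNge invr_gt0 ltr0n. Qed.

Lemma cutoff1 n : cutoff n 1 = 0.
Proof.
by rewrite cutoff_eq0// in_itv/= negb_and -!ltNge ltrBlDr ltrDl invr_gt0 ltr0n orbT.
Qed.

Lemma cvg_cutoff t : 0 < t < 1 -> cutoff n t @[n --> \oo] --> (1 : R).
Proof.
move=> /andP[t0 t1]; apply: (cvg_near_cst).
have ut : 0 < 2 / t by rewrite divr_gt0.
have u1t : 0 < 2 / (1 - t) by rewrite divr_gt0// subr_gt0.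
near=> n.
have h1 : 2 / t <= n.+1%:R.
  by near: n; exists (Num.truncn (2 / t)) => // n /= hn;
    rewrite ltW// -truncn_le_nat.
have h2 : 2 / (1 - t) <= n.+1%:R.
  by near: n; exists (Num.truncn (2 / (1 - t))) => // n /= hn;
    rewrite ltW// -truncn_le_nat.
rewrite /cutoff !smooth_step_ge1 ?mulr1//.
- by move: h2; rewrite ler_pdivrMr ?subr_gt0//; lra.
- by move: h1; rewrite ler_pdivrMr//; lra.
Unshelve. all: by end_near. Qed.

Lemma derive1_cutoff n t : derive1 (cutoff n) t =
  derive1 smooth_step (-1 + n.+1%:R * t) * n.+1%:R *
    smooth_step (n.+1%:R - 1 + (- n.+1%:R) * t) -
  smooth_step (-1 + n.+1%:R * t) *
    (derive1 smooth_step (n.+1%:R - 1 + (- n.+1%:R) * t) * n.+1%:R).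
Proof.
rewrite /cutoff; move: (@smooth_smooth_step R) => sS.
move: smooth_step sS (n.+1%:R) (-1) (n.+1%:R - 1) => S sS N a b.
have -> : (fun t => S (a + N * t) * S (b + - N * t)) =
  (fun t => S (a + N * t)) \* (fun t => S (b + - N * t)) by [].
rewrite smooth_derive1M; [|exact: smooth_comp_affine..].
have /= -> := derive1_comp_affine a N t sS.
have /= -> := derive1_comp_affine b (- N) t sS.
by rewrite !mulrN.
Qed.

Lemma Rintegral_cutoff f : mu.-integrable `[0, 1] (EFin \o f) ->
  \int[mu]_(t in `[0, 1]) (cutoff n t * f t) @[n --> \oo] -->
  \int[mu]_(t in `[0, 1]) f t.
Proof.
move=> fi.
have fo : mu.-integrable `]0, 1[ (EFin \o f).
  by apply: integrableS fi => //; exact: subset_itv_oo_cc.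
have oo g : mu.-integrable `[0, 1] (EFin \o g) ->
    \int[mu]_(t in `[0, 1]) g t = \int[mu]_(t in `]0, 1[) g t.
  move=> gi; rewrite /Rintegral integral_itv_bndoo//.
  apply: (@measurable_int _ _ _ mu); apply: integrableS gi => //.
  exact: subset_itv_oo_cc.
have fni n : mu.-integrable `[0, 1] (EFin \o (fun t => cutoff n t * f t)).
  by apply: integrable_continuousM => //; exact: smooth_continuous (smooth_cutoff n).
rewrite oo//; under eq_fun do rewrite oo//.
apply: fine_cvg; rewrite fineK; last exact: integrable_fin_num fo.
apply: (@dominated_cvg _ _ _ mu `]0, 1[ _ _ _ (fun t => (`|f t|)%:E)) => //.
- by move=> n; apply: (@measurable_int _ _ _ mu); apply: integrableS (fni n) => //;
    exact: subset_itv_oo_cc.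
- move=> t /=; rewrite in_itv/= => t01.
  apply/cvg_EFin; first exact: nearW.
  rewrite -[X in _ --> X]mul1r; apply: cvgM (cvg_cst _).
  exact: cvg_cutoff.
- exact: integrable_norm.
- move=> n t _ /=; rewrite lee_fin normrM ler_piMl//; exact: cutoff_norm_le1.
Qed.

(** The derivative of the cutoff has size of order [n] on two intervals of length
    [2 / n.+1] at the ends of the unit interval and vanishes elsewhere, so that its
    integral against [h] is bounded by the values of [h] near the ends. *)
Lemma Rintegral_derive1_cutoff h : {within `[0, 1], continuous h} ->
  h 0 = 0 -> h 1 = 0 ->
  \int[mu]_(t in `[0, 1]) (derive1 (cutoff n) t * h t) @[n --> \oo] --> 0.
Proof.
move=> ch h0 h1.
have [M M0 SM] := @derive1_smooth_step_bounded R.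
apply/cvgr0Pnorm_lt => e e0.
(* With [N = n.+1], each end contributes at most [N * M * d * (2 / N)]. *)
pose d := e / (4 * M + 1).
have M4 : 0 < 4 * M + 1 by rewrite ltr_pwDr// mulr_ge0.
have d0 : 0 < d by rewrite divr_gt0.
move/continuous_within_itvP : (ch) => /(_ ltr01) [_].
rewrite h0 h1 => ch0 ch1.
have [r/= r0 Hr] : \forall t \near 0^'+, `|h t| < d.
  exact: cvgr0_norm_lt ch0 _ d0.
have [q/= q0 Hq] : \forall t \near 1^'-, `|h t| < d.
  exact: cvgr0_norm_lt ch1 _ d0.
near=> n.
have N0 : 0 < n.+1%:R :> R by rewrite ltr0n.
set N := n.+1%:R in N0.
have big c : 0 < c -> 2 / c < N -> 2 / N < c.
  by move=> c0; rewrite !ltr_pdivrMr// mulrC.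
have Nr : 2 / N < r.
  apply: big => //; rewrite -truncn_le_nat.
  by near: n; exists (Num.truncn (2 / r)).
have Nq : 2 / N < q.
  apply: big => //; rewrite -truncn_le_nat.
  by near: n; exists (Num.truncn (2 / q)).
have N1 : 2 / N < 1.
  apply: big => //; rewrite -truncn_le_nat.
  by near: n; exists (Num.truncn (2 / 1 : R)).
have N2 : 0 < 2 / N by rewrite divr_gt0.
have hi : mu.-integrable `[0, 1] (EFin \o h) by exact: integrable_within_continuous.
pose F1 t := derive1 smooth_step (-1 + N * t) * N *
    smooth_step (N - 1 + (- N) * t).
pose F2 t := smooth_step (-1 + N * t) *
    (derive1 smooth_step (N - 1 + (- N) * t) * N).
have sS := @smooth_smooth_step R.
have cF1 : continuous F1.
  apply: smooth_continuous; apply: smoothM; last exact: smooth_comp_affine.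
  apply: smoothM; last exact: smooth_cst.
  exact/smooth_comp_affine/smooth_derive.
have cF2 : continuous F2.
  apply: smooth_continuous; apply: smoothM; first exact: smooth_comp_affine.
  apply: smoothM; last exact: smooth_cst.
  exact/smooth_comp_affine/smooth_derive.
have i1 := integrable_continuousM cF1 hi.
have i2 := integrable_continuousM cF2 hi.
have -> : \int[mu]_(t in `[0, 1]) (derive1 (cutoff n) t * h t) =
    \int[mu]_(t in `[0, 1]) (F1 t * h t) - \int[mu]_(t in `[0, 1]) (F2 t * h t).
  rewrite -RintegralB//; apply: eq_Rintegral => t _.
  by rewrite derive1_cutoff mulrBl.
have s1 : `[0, 2 / N]%classic `<=` (`[0, 1]%classic : set R).
  by apply: subset_itvl; rewrite bnd_simp ltW.
have s2 : `[1 - 2 / N, 1]%classic `<=` (`[0, 1]%classic : set R).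
  by apply: subset_itvr; rewrite bnd_simp subr_ge0 ltW.
have E1 : `|\int[mu]_(t in `[0, 1]) (F1 t * h t)| <= N * M * d * (2 / N - 0).
  rewrite (@Rintegral_vanish _ _ `[0, 2 / N]%classic)//.
    apply: normr_Rintegral_le; [exact: ltW|exact: integrableS i1|].
    move=> t /andP[t0 tN]; rewrite normrM; apply: ler_pM => //.
      rewrite /F1 !normrM (gtr0_norm N0) -[leRHS]mulr1.
      apply: ler_pM => //; last exact: smooth_step_norm_le1.
        by rewrite mulr_ge0// ltW.
      by rewrite mulrC ler_pM2l.
    move: t0; rewrite le_eqVlt => /predU1P[<-|t0]; first by rewrite h0 normr0 ltW.
    by apply/ltW/Hr => //=; rewrite sub0r normrN gtr0_norm// (le_lt_trans tN).
  move=> t /=; rewrite !in_itv/= => /andP[t0 t1] /negP.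
  rewrite t0/= -ltNge ltr_pdivrMr// => tN.
  rewrite /F1 derive1_smooth_step_gt1 ?mul0r//.
  by rewrite -ltrBlDl opprK -[1 + 1]/(2%:R) mulrC.
have E2 : `|\int[mu]_(t in `[0, 1]) (F2 t * h t)| <= N * M * d * (1 - (1 - 2 / N)).
  rewrite (@Rintegral_vanish _ _ `[1 - 2 / N, 1]%classic)//.
    apply: normr_Rintegral_le; [by rewrite gerBl ltW|exact: integrableS i2|].
    move=> t /andP[tN t1]; rewrite normrM; apply: ler_pM => //.
      rewrite /F2 !normrM (gtr0_norm N0) -[leRHS]mul1r.
      apply: ler_pM => //; first by rewrite mulr_ge0// ltW.
        exact: smooth_step_norm_le1.
      by rewrite mulrC ler_pM2l.
    move: t1; rewrite le_eqVlt => /predU1P[->|t1]; first by rewrite h1 normr0 ltW.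
    apply/ltW/Hq => //=; rewrite gtr0_norm ?subr_gt0//.
    by apply: le_lt_trans Nq; rewrite lerBlDl -lerBlDr.
  move=> t /=; rewrite !in_itv/= => /andP[t0 t1] /negP.
  rewrite t1/= andbT -ltNge ltrBrDl -ltrBrDr ltr_pdivrMr// => tN.
  rewrite /F2 derive1_smooth_step_gt1 ?mul0r ?mulr0 ?mul0r//.
  have -> : N - 1 + - N * t = (1 - t) * N - 1 by ring.
  by rewrite ltrBrDr.
apply: le_lt_trans (ler_normB _ _) _.
apply: le_lt_trans (lerD E1 E2) _.
have -> : N * M * d * (2 / N - 0) + N * M * d * (1 - (1 - 2 / N)) = 4 * M * d.
  by field; rewrite gt_eqF.
by rewrite /d mulrA ltr_pdivrMr// [ltLHS]mulrC ltr_pM2l// ltrDl.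
Unshelve. all: by end_near. Qed.

End cutoff.

(** * The weak continuity equation with boundary terms *)

Section weak_formulation.
Context {R : realType}.
Notation mu := (@lebesgue_measure R).
Implicit Types (f g h phi : R -> R).

Lemma test_function_smooth phi : test_function phi -> smooth phi.
Proof. by move=> [sphi _]; apply/smoothP. Qed.

Lemma test_function_eq0 phi t : test_function phi -> t \notin `[0, 1] ->
  phi t = 0 /\ derive1 phi t = 0.
Proof.
move=> [_ [u [v [u0 v1 phi0]]]]; rewrite in_itv/= negb_and -!ltNge => t01.
split.
  apply: phi0; rewrite in_itv/= negb_and -!ltNge; apply/orP.
  by case/orP: t01 => ?; [left; exact: lt_trans u0|right; exact: lt_trans v1 _].
rewrite derive1E (@near_eq_derive _ R^o R^o _ (cst 0)) ?derive_cst//.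
case/orP: t01 => t01; near=> z; apply: phi0; rewrite in_itv/= negb_and -!ltNge.
  by rewrite (lt_trans _ u0)//; near: z; exact: lt_nbhsl.
by rewrite (lt_trans v1) ?orbT//; near: z; exact: lt_nbhsr.
Unshelve. all: by end_near. Qed.

Lemma test_function_cutoff phi n : smooth phi ->
  test_function (phi \* cutoff n).
Proof.
move=> sphi; split; first by apply/smoothP/smoothM => //; exact: smooth_cutoff.
exists n.+1%:R^-1, (1 - n.+1%:R^-1); split.
- by rewrite invr_gt0 ltr0n.
- by rewrite ltrBlDr ltrDl invr_gt0 ltr0n.
- by move=> t tn; rewrite /= cutoff_eq0// mulr0.
Qed.

Let limit_identity (a b c d : R^nat) (la lb lc ld k : R) :
  a @ \oo --> la -> b @ \oo --> lb -> c @ \oo --> lc -> d @ \oo --> ld ->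
  (forall n, a n + b n - k * c n - d n = 0) -> la + lb - k * lc - ld = 0.
Proof.
move=> al bl cl dl e0.
have ck : (fun n => k * c n) @ \oo --> k * lc by apply: cvgM cl; exact: cvg_cst.
have cv := cvgB (cvgB (cvgD al bl) ck) dl.
have e : (a + b - (fun n => k * c n) - d : R^nat) = cst 0.
  by apply/funext => n; exact: e0.
have {}cv : (a + b - (fun n => k * c n) - d : R^nat) @ \oo -->
  la + lb - k * lc - ld by exact: cv.
rewrite e in cv; have <- := cvg_lim (@Rhausdorff R) cv.
by rewrite lim_cst.
Qed.

(** Multiplying [phi] by a cutoff gives an admissible test function. The derivative
    falling on the cutoff produces the boundary terms: after subtracting from
    [phi * h] the affine function [A] with the same endpoint values, what remains
    vanishes at both ends and contributes nothing in the limit, while the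
    contribution of [A] is computed by the fundamental theorem of calculus. *)
Lemma weak_boundary h g phi : {within `[0, 1], continuous h} ->
  mu.-integrable `[0, 1] (EFin \o g) ->
  (forall psi, test_function psi ->
    - (\int[mu]_(t in `[0, 1]) (derive1 psi t * h t))
    + \int[mu]_(t in `[0, 1]) (psi t * g t) = 0) ->
  smooth phi ->
  \int[mu]_(t in `[0, 1]) (derive1 phi t * h t) =
    phi 1 * h 1 - phi 0 * h 0 + \int[mu]_(t in `[0, 1]) (phi t * g t).
Proof.
move=> ch gi weak sphi.
have cphi := smooth_continuous sphi.
have cphi' := smooth_continuous (smooth_derive sphi).
pose k0 := phi 0 * h 0; pose k1 := phi 1 * h 1.
pose A t := k0 + (k1 - k0) * t.
pose K t := phi t * h t - A t.
have sA : smooth A by exact: smooth_affine.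
have chs := ch; move/subspace_continuousP in chs.
have cK : {within `[0, 1], continuous K}.
  apply/subspace_continuousP => t t01; apply: cvgB.
    apply: cvgM; last exact: chs.
    by apply: cvg_within_filter; exact: cphi.
  by apply: cvg_within_filter; exact: (smooth_continuous sA).
have K0 : K 0 = 0 by rewrite /K /A mulr0 addr0 subrr.
have K1 : K 1 = 0 by rewrite /K /A mulr1 [k0 + _]addrC subrK subrr.
have hi := integrable_within_continuous ch.
have Ki := integrable_within_continuous cK.
have phi'hi := integrable_continuousM cphi' hi.
have phigi := integrable_continuousM cphi gi.
have onei : mu.-integrable `[0, 1] (EFin \o (cst 1 : R -> R)).
  apply: integrable_within_continuous.
  by apply: continuous_subspaceT => ?; exact: cvg_cst.
have cc n : continuous (@cutoff R n) by exact: smooth_continuous (smooth_cutoff n).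
have cc' n : continuous (derive1 (@cutoff R n)).
  exact: smooth_continuous (smooth_derive (smooth_cutoff n)).
have main n : \int[mu]_(t in `[0, 1]) (cutoff n t * (derive1 phi t * h t)) +
    \int[mu]_(t in `[0, 1]) (derive1 (cutoff n) t * K t) -
    (k1 - k0) * \int[mu]_(t in `[0, 1]) (cutoff n t * 1) -
    \int[mu]_(t in `[0, 1]) (cutoff n t * (phi t * g t)) = 0.
  have FTC : \int[mu]_(t in `[0, 1]) derive1 (cutoff n \* A) t = 0.
    rewrite smooth_FTC2//; last by apply: smoothM => //; exact: smooth_cutoff.
    by rewrite /= cutoff0 cutoff1 !mul0r subrr.
  have Ai : mu.-integrable `[0, 1] (EFin \o A).
    by apply: integrable_within_continuous; apply: continuous_subspaceT;
      exact: smooth_continuous.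
  have i1 := integrable_continuousM (cc' n) Ai.
  have i2 := integrable_continuousM (cc n) onei.
  have i3 := integrable_continuousM (cc' n) Ki.
  have i4 := integrable_continuousM (cc n) phi'hi.
  have {}FTC : \int[mu]_(t in `[0, 1]) (derive1 (cutoff n) t * A t) +
      (k1 - k0) * \int[mu]_(t in `[0, 1]) (cutoff n t * 1) = 0.
    rewrite -[RHS]FTC -RintegralZl// -RintegralD//; last first.
      apply: eq_integrable (integrableZl _ (k1 - k0) i2) => // t _.
    apply: eq_Rintegral => t _.
    rewrite smooth_derive1M//; last exact: smooth_cutoff.
    by rewrite /= /A derive1_affine/=; ring.
  have := weak _ (test_function_cutoff n sphi).
  have -> : \int[mu]_(t in `[0, 1]) (derive1 (phi \* cutoff n) t * h t) =
      \int[mu]_(t in `[0, 1]) (cutoff n t * (derive1 phi t * h t)) +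
      (\int[mu]_(t in `[0, 1]) (derive1 (cutoff n) t * K t) +
       \int[mu]_(t in `[0, 1]) (derive1 (cutoff n) t * A t)).
    rewrite -RintegralD// -RintegralD//; last first.
      by apply: eq_integrable (integrableD _ i3 i1).
    apply: eq_Rintegral => t _; rewrite smooth_derive1M//; last exact: smooth_cutoff.
    by rewrite /= /K; ring.
  have -> : \int[mu]_(t in `[0, 1]) ((phi \* cutoff n) t * g t) =
      \int[mu]_(t in `[0, 1]) (cutoff n t * (phi t * g t)).
    by apply: eq_Rintegral => t _ /=; ring.
  move: FTC; lra.
have lim : \int[mu]_(t in `[0, 1]) (derive1 phi t * h t) + 0 -
    (k1 - k0) * \int[mu]_(t in `[0, 1]) 1 -
    \int[mu]_(t in `[0, 1]) (phi t * g t) = 0.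
  apply: (limit_identity (Rintegral_cutoff phi'hi)
    (Rintegral_derive1_cutoff cK K0 K1) _ (Rintegral_cutoff phigi) main).
  exact: Rintegral_cutoff onei.
move: lim; rewrite Rintegral_cst//= lebesgue_measure_itv/= lte_fin ltr01/=.
by rewrite -/k0 -/k1; lra.
Qed.

End weak_formulation.

(** * Curves of measures and their reparametrisation *)

Section outflow.
Context {R : realType} {X : finType}.

Definition outflow (v : X -> X -> R) (x : X) : R :=
  2^-1 * \sum_y (v x y - v y x).

Lemma outflowZ c v x : outflow (fun y z => c * v y z) x = c * outflow v x.
Proof.
rewrite /outflow mulrCA; congr (_ * _); rewrite mulr_sumr.
by apply: eq_bigr => y _; rewrite mulrBr.
Qed.

Lemma outflowD v w x :
  outflow (fun y z => v y z + w y z) x = outflow v x + outflow w x.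
Proof.
rewrite /outflow -mulrDr -big_split/=; congr (_ * _).
by apply: eq_bigr => y _; rewrite opprD addrACA.
Qed.

Lemma outflow0 x : outflow (fun _ _ => 0) x = 0.
Proof. by rewrite /outflow big1 ?mulr0// => y _; rewrite subrr. Qed.

Lemma outflow_sum (I : Type) (r : seq I) (v : I -> X -> X -> R) x :
  outflow (fun y z => \sum_(i <- r) v i y z) x = \sum_(i <- r) outflow (v i) x.
Proof.
elim: r => [|i r ih].
  rewrite big_nil -[RHS](outflow0 x); congr outflow.
  by apply/funext => y; apply/funext => z; rewrite big_nil.
rewrite big_cons -ih -outflowD; congr outflow.
by apply/funext => y; apply/funext => z; rewrite big_cons.
Qed.

End outflow.

Section curves.
Context {R : realType} {X : finType} (Q : X -> X -> R) (L : R * R -> R).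
Hypothesis hL : admissible_mean L.
Hypothesis Q_ge0 : forall x y, 0 <= Q x y.
Notation mu := (@lebesgue_measure R).
Implicit Types (m : R -> X -> R) (V : R -> X -> X -> R)(nu : X -> R).

Lemma action_ge0 (q : X -> R) v : (0 <= action Q L q v)%E.
Proof.
rewrite /action mule_ge0 ?lee_fin ?invr_ge0//.
by apply: sume_ge0 => x _; apply: sume_ge0 => y _; exact: action_density_ge0.
Qed.

Lemma actionZ (q : X -> R) v c : c != 0 ->
  action Q L q (fun x y => c * v x y) = ((c ^+ 2)%:E * action Q L q v)%E.
Proof.
move=> c0; rewrite /action muleCA; congr (_ * _)%E.
rewrite ge0_sume_distrr; last first.
  by move=> x _; apply: sume_ge0 => y _; exact: action_density_ge0.
apply: eq_bigr => x _; rewrite ge0_sume_distrr; last first.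
  by move=> y _; exact: action_density_ge0.
by apply: eq_bigr => y _; rewrite action_densityZ.
Qed.

Lemma CE1_integrable nu0 nu1 m V x y : CE1 nu0 nu1 m V ->
  mu.-integrable `[0, 1] (EFin \o (fun t => V t x y)).
Proof. by move=> h; apply: (ce_integrable h) => //; exact: segment_compact. Qed.

Lemma integrable_loc_integrable (f : R -> R) :
  mu.-integrable `[0, 1] (EFin \o f) -> loc_integrable `[0, 1] f.
Proof.
move=> fi K K01 cK; apply: integrableS fi => //; exact: compact_measurable.
Qed.

Lemma integrable_outflow V x :
  (forall y z, mu.-integrable `[0, 1] (EFin \o (fun t => V t y z))) ->
  mu.-integrable `[0, 1] (EFin \o (fun t => outflow (V t) x)).
Proof.
move=> Vi; rewrite /outflow.
rewrite (_ : _ \o _ = (fun t => (2^-1)%:E *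
    \sum_y ((V t x y)%:E - (V t y x)%:E)))%E; last first.
  by apply/funext => t /=; rewrite EFinM -sumEFin.
apply: integrableZl => //; apply: integrable_sum => // y _.
by apply: integrableB => //; exact: Vi.
Qed.

Lemma CE1_within nu0 nu1 m V x : CE1 nu0 nu1 m V ->
  {within `[0, 1], continuous (fun t => m t x)}.
Proof. by move=> h; exact: (ce_continuous h). Qed.

(** The form of the continuity equation that survives gluing and restriction: the
    test function need not vanish at the ends. *)
Lemma CE1_boundary nu0 nu1 m V x phi : CE1 nu0 nu1 m V -> smooth phi ->
  \int[mu]_(t in `[0, 1]) (derive1 phi t * m t x) =
  phi 1 * nu1 x - phi 0 * nu0 x +
  \int[mu]_(t in `[0, 1]) (phi t * outflow (V t) x).
Proof.
move=> h sphi; rewrite -(ce_start h) -(ce_end h).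
apply: (@weak_boundary _ (fun t => m t x) (fun t => outflow (V t) x)) => //.
  exact: CE1_within h.
  by apply: integrable_outflow => y z; exact: CE1_integrable h.
by move=> psi tpsi; exact: (ce_weak h x tpsi).
Qed.

Lemma measurable_action m V :
  (forall x, {within `[0, 1], continuous (fun t => m t x)}) ->
  (forall t, 0 <= t <= 1 -> prob (m t)) ->
  (forall x y, measurable_fun (`[0, 1]%classic : set R) (fun t => V t x y)) ->
  measurable_fun (`[0, 1]%classic : set R) (fun t => action Q L (m t) (V t)).
Proof.
move=> cm pm mV; rewrite /action; apply: measurable_funeM.
apply: emeasurable_sum => x; apply: emeasurable_sum => y.
have cont z z' : {within `[0, 1], continuous (fun t => m t z * Q z z')}.
  apply/subspace_continuousP => t t01; apply: cvgM; last exact: cvg_cst.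
  by have /subspace_continuousP := cm z; exact.
have ge0 z z' t : `[0, 1]%classic t -> 0 <= m t z * Q z z'.
  rewrite /= in_itv/= => t01; rewrite mulr_ge0//.
  by have [] := pm _ t01.
apply: measurable_action_density => //; [exact: ge0|exact: ge0].
Qed.

Lemma CE1_measurable_action nu0 nu1 m V : CE1 nu0 nu1 m V ->
  measurable_fun (`[0, 1]%classic : set R) (fun t => action Q L (m t) (V t)).
Proof.
move=> h; apply: measurable_action => [x|t|x y].
- exact: CE1_within h.
- exact: (ce_prob h).
- by have /measurable_int/measurable_EFinP := CE1_integrable x y h.
Qed.

Lemma within_continuous_affine (D D' : set R) (f : R -> R) a c :
  (forall t, D' t -> D (a + c * t)) -> {within D, continuous f} ->
  {within D', continuous (fun t => f (a + c * t))}.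
Proof.
move=> DD' /subspace_continuousP cf.
have ca : continuous (fun s : R => a + c * s).
  exact: (smooth_continuous (@smooth_affine R a c)).
have cg (t : R) : D' t -> f (a + c * s) @[s --> within D' (nbhs t)] --> f (a + c * t).
  move=> D't U /(cf _ (DD' _ D't)) nU; have := ca t _ nU.
  move=> h1; change (nbhs t [set s | D' s -> U (f (a + c * s))]).
  apply: (@filterS _ _ (nbhs_filter t) _ _ _ h1) => s /= hs D's.
  exact: hs (DD' _ D's).
by apply/subspace_continuousP => t D't; exact: cg.
Qed.

(** Restriction to a subinterval ([0 < c]) and time reversal ([c < 0]) are both
    affine reparametrisations. *)
Section affine_reparametrisation.
Variables (a c : R).
Hypotheses (c0 : c != 0) (a01 : 0 <= a <= 1) (ac01 : 0 <= a + c <= 1).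

(** The image of the unit interval under [t |-> a + c * t]. *)
Let D' : set R := `[Num.min a (a + c), Num.max a (a + c)]%classic.

Let preimD' : (fun t => a + c * t) @^-1` D' = `[0, 1]%classic.
Proof.
rewrite /D'; apply/seteqP.
suff H t : (Num.min a (a + c) <= a + c * t <= Num.max a (a + c)) = (0 <= t <= 1).
  by split => t /=; rewrite !in_itv/= H.
move: c0; rewrite neq_lt => /orP[] cs.
  rewrite minElt maxElt ltrDl ltNge (ltW cs)/=.
  by rewrite lerD2l ler_nMr// gerDl nmulr_rle0// andbC.
rewrite minElt maxElt ltrDl cs.
by rewrite lerD2l ger_pMr// lerDl pmulr_rge0.
Qed.

Let D'01 : D' `<=` `[0, 1]%classic.
Proof.
move=> t; rewrite /D' /= !in_itv/= ge_min le_max.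
case/andP: a01 => a0 a1; case/andP: ac01 => ac0 ac1.
move=> /andP[/orP[]h1 /orP[]h2]; apply/andP; split; lra.
Qed.

Let mD' : measurable D'. Proof. exact: measurable_itv. Qed.

Let ell01 t : `[0, 1]%classic t -> `[0, 1]%classic (a + c * t).
Proof. by rewrite -{1}preimD' => /D'01. Qed.

Let Rsubst (F : R -> R) : mu.-integrable `[0, 1] (EFin \o F) ->
  (forall t, 0 <= t <= 1 -> ~ D' t -> F t = 0) ->
  \int[mu]_(t in `[0, 1]) F t = `|c| * \int[mu]_(t in `[0, 1]) F (a + c * t).
Proof.
move=> Fi F0; rewrite (@Rintegral_vanish _ _ D')//.
rewrite (Rintegral_affine a c0)//; last exact: integrableS Fi.
by rewrite preimD'.
Qed.

(** A test function for the new curve, transported to the image interval and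
    extended by [0], is a test function for the old one. *)
Lemma CE1_affine nu0 nu1 m V : CE1 nu0 nu1 m V ->
  CE1 (m a) (m (a + c)) (fun t => m (a + c * t))
      (fun t x y => c * V (a + c * t) x y).
Proof.
move=> h; split.
- move=> t t01; apply: (ce_prob h).
  by have := @ell01 t; rewrite /= !in_itv/=; exact.
- move=> x.
  apply: (@within_continuous_affine `[0, 1]%classic _ (fun t => m t x)).
    exact: ell01.
  exact: CE1_within h.
- move=> x y; apply: integrable_loc_integrable.
  have Vi : mu.-integrable D' (EFin \o (fun t => V t x y)).
    by apply: integrableS (CE1_integrable x y h).
  have Vai := integrable_affine a c0 mD' Vi.
  rewrite preimD' in Vai.
  exact: (integrableZl _ c Vai).
- by rewrite mulr0 addr0.
- by rewrite mulr1.
- move=> x phi tphi.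
  have sphi := test_function_smooth tphi.
  pose psi t := phi (- a / c + c^-1 * t).
  have spsi : smooth psi by exact: smooth_comp_affine.
  have psi' t : derive1 psi t = derive1 phi (- a / c + c^-1 * t) * c^-1.
    exact: derive1_comp_affine.
  have inv_ell t : - a / c + c^-1 * (a + c * t) = t by field.
  have out t : ~ D' t -> psi t = 0 /\ derive1 psi t = 0.
    move=> nD't; rewrite psi' /psi.
    have [|-> ->] := @test_function_eq0 _ phi (- a / c + c^-1 * t) tphi.
      apply/negP => h01; apply: nD't.
      have : `[0, 1]%classic (- a / c + c^-1 * t) by [].
      rewrite -preimD' /= (_ : a + _ = t)//.
      by field.
    by rewrite mul0r.
  have tpsi : test_function psi.
    split; first exact/smoothP.
    (* The support moves to the image of [u, v], whose ends are swapped by a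
       reversal. *)
    case: tphi => _ [u [v [u0 v1 phi0]]].
    case/andP: a01 => a0 a1; case/andP: ac01 => ac0 ac1.
    have cD t : a + c * (- a / c + c^-1 * t) = t by field.
    move: c0; rewrite neq_lt => /orP[] cs.
      exists (a + c * v), (a + c * u); split.
      + have : 0 < c * (v - 1) by rewrite nmulr_rgt0// subr_lt0.
        by rewrite mulrBr mulr1; lra.
      + have : c * u < 0 by rewrite nmulr_rlt0.
        lra.
      + move=> t tuv; apply: phi0; apply: contra tuv; rewrite !in_itv/=.
        have := cD t; set s := - a / c + _ => <-.
        by rewrite !lerD2l !ler_nM2l// andbC.
    exists (a + c * u), (a + c * v); split.
    + have : 0 < c * u by rewrite mulr_gt0.
      lra.
    + have : c * (v - 1) < 0 by rewrite pmulr_rlt0// subr_lt0.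
      by rewrite mulrBr mulr1; lra.
    + move=> t tuv; apply: phi0; apply: contra tuv; rewrite !in_itv/=.
        have := cD t; set s := - a / c + _ => <-.
      by rewrite !lerD2l !ler_pM2l.
  have mci : mu.-integrable `[0, 1]
      (EFin \o (fun t => derive1 phi t * m (a + c * t) x)).
    apply: integrable_continuousM;
      first exact: (smooth_continuous (smooth_derive sphi)).
    apply: integrable_within_continuous.
    apply: (@within_continuous_affine `[0, 1]%classic _ (fun t => m t x)).
      exact: ell01.
    exact: CE1_within h.
  have oi : mu.-integrable `[0, 1] (EFin \o (fun t => outflow (V t) x)).
    by apply: integrable_outflow => y z; exact: CE1_integrable h.
  have oci : mu.-integrable `[0, 1]
      (EFin \o (fun t => phi t * outflow (V (a + c * t)) x)).
    apply: integrable_continuousM; first exact: (smooth_continuous sphi).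
    have oiD : mu.-integrable D' (EFin \o (fun t => outflow (V t) x)).
      exact: integrableS oi.
    have oai := integrable_affine a c0 mD' oiD.
    by rewrite preimD' in oai.
  have e1 : \int[mu]_(t in `[0, 1]) (derive1 psi t * m t x) =
      `|c| * (c^-1 * \int[mu]_(t in `[0, 1]) (derive1 phi t * m (a + c * t) x)).
    rewrite Rsubst; last 2 first.
    - apply: integrable_continuousM;
      first exact: (smooth_continuous (smooth_derive spsi)).
      by apply: integrable_within_continuous; exact: CE1_within h.
    - by move=> t _ /out[_ ->]; rewrite mul0r.
    rewrite -[X in _ = _ * X]RintegralZl//; congr (_ * _); apply: eq_Rintegral => t _.
    by rewrite psi' inv_ell mulrAC mulrC.
  have e2 : \int[mu]_(t in `[0, 1]) (psi t * outflow (V t) x) =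
      `|c| * \int[mu]_(t in `[0, 1]) (phi t * outflow (V (a + c * t)) x).
    rewrite Rsubst; last 2 first.
    - by apply: integrable_continuousM => //; exact: (smooth_continuous spsi).
    - by move=> t _ /out[-> _]; rewrite mul0r.
    by congr (_ * _); apply: eq_Rintegral => t _; rewrite /psi inv_ell.
  have weak : - (\int[mu]_(t in `[0, 1]) (derive1 psi t * m t x)) +
      \int[mu]_(t in `[0, 1]) (psi t * outflow (V t) x) = 0 := ce_weak h x tpsi.
  rewrite e1 e2 in weak.
  have -> : \int[mu]_(t in `[0, 1]) (phi t * (2^-1 *
      \sum_y (c * V (a + c * t) x y - c * V (a + c * t) y x))) =
      c * \int[mu]_(t in `[0, 1]) (phi t * outflow (V (a + c * t)) x).
    rewrite -RintegralZl//; apply: eq_Rintegral => t _.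
    by rewrite [RHS]mulrCA -outflowZ.
  move: weak; move: (Rintegral _ _ _) (Rintegral _ _ _) => I1 I2 weak.
  apply: (@mulfI _ (`|c| * c^-1)); first by rewrite mulf_neq0 ?normr_eq0 ?invr_eq0.
  by rewrite mulr0 -[RHS]weak; field.
Qed.

Lemma energy_affine nu0 nu1 m V : CE1 nu0 nu1 m V ->
  (\int[mu]_(t in `[0%R, 1%R])
     action Q L (m (a + c * t)%R) (fun x y => c * V (a + c * t) x y)%R
   = `|c|%:E * \int[mu]_(t in `[Num.min a (a + c)%R, Num.max a (a + c)%R])
       action Q L (m t) (V t))%E.
Proof.
move=> h; have mA := CE1_measurable_action h.
have mAD : measurable_fun D' (fun t => action Q L (m t) (V t)).
  exact: measurable_funS mA.
rewrite -[X in (_ = _ * X)%E]/(\int[mu]_(t in D') action Q L (m t) (V t))%E.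
rewrite (ge0_integral_affine a c0 mD' mAD); last by move=> t _; exact: action_ge0.
rewrite preimD' muleA -EFinM -normrM -expr2 ger0_norm ?sqr_ge0//.
rewrite -ge0_integralZl//; last 3 first.
- rewrite -preimD'; apply: (@measurable_comp _ _ _ _ _ _ D'
    (fun t => action Q L (m t) (V t)) _ (fun t => a + c * t)) => //.
  + by move=> _ [t Dt <-].
  + apply: measurable_funTS; apply: continuous_measurable_fun.
    exact: (smooth_continuous (@smooth_affine R a c)).
- by move=> t _; exact: action_ge0.
- by rewrite lee_fin sqr_ge0.
by apply: eq_integral => t _; rewrite actionZ.
Qed.

End affine_reparametrisation.
End curves.

(** * Gluing of curves and the triangle inequality *)

Section split_integrals.
Context {R : realType}.
Notation mu := (@lebesgue_measure R).
Variable tau : R.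
Hypothesis tau01 : 0 < tau < 1.

Let I01 : `[0, 1]%classic = `[0, tau]%classic `|` `]tau, 1]%classic :> set R.
Proof.
case/andP: tau01 => t0 t1.
by rewrite -itv_bndbnd_setU// bnd_simp// ltW.
Qed.

Let I01_disj : [disjoint (`[0, tau]%classic : set R) & `]tau, 1]%classic].
Proof.
rewrite disj_set2E; apply/eqP/seteqP; split => // t [] /=.
by rewrite !in_itv/= => /andP[_ +] /andP[+ _]; case: ltgtP.
Qed.

Lemma ge0_integral_split (f f1 f2 : R -> \bar R) :
  (forall t, 0 <= t <= tau -> f t = f1 t) ->
  (forall t, tau < t <= 1 -> f t = f2 t) ->
  measurable_fun (`[0, tau]%classic : set R) f1 ->
  measurable_fun (`[tau, 1]%classic : set R) f2 ->
  (forall t, 0 <= f1 t)%E -> (forall t, 0 <= f2 t)%E ->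
  measurable_fun (`[0, 1]%classic : set R) f /\
  (\int[mu]_(t in `[0%R, 1%R]) f t =
   \int[mu]_(t in `[0%R, tau]) f1 t + \int[mu]_(t in `[tau, 1%R]) f2 t)%E.
Proof.
move=> ff1 ff2 mf1 mf2 f10 f20.
have mf2' : measurable_fun (`]tau, 1]%classic : set R) f2.
  by apply: measurable_funS mf2 => //; exact: subset_itv_oc_cc.
have mf : measurable_fun (`[0, tau]%classic `|` `]tau, 1]%classic : set R) f.
  apply/measurable_funU => //; split.
    apply: eq_measurable_fun mf1 => t; rewrite inE/= in_itv/= => h.
    by rewrite ff1.
  apply: eq_measurable_fun mf2' => t; rewrite inE/= in_itv/= => h.
  by rewrite ff2.
split; first by rewrite I01.
rewrite I01 ge0_integral_setU//; last first.
  move=> t [] /=; rewrite in_itv/= => h; [by rewrite ff1|by rewrite ff2].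
congr (_ + _)%E.
  by apply: eq_integral => t; rewrite inE/= in_itv/= => h; rewrite ff1.
rewrite -integral_itv_obnd_cbnd//.
by apply: eq_integral => t; rewrite inE/= in_itv/= => h; rewrite ff2.
Qed.

Lemma integrable_split (f f1 f2 : R -> R) :
  (forall t, 0 <= t <= tau -> f t = f1 t) ->
  (forall t, tau < t <= 1 -> f t = f2 t) ->
  mu.-integrable `[0, tau] (EFin \o f1) ->
  mu.-integrable `[tau, 1] (EFin \o f2) ->
  mu.-integrable `[0, 1] (EFin \o f).
Proof.
move=> ff1 ff2 /integrableP[mf1 i1] /integrableP[mf2 i2].
have mf2' : measurable_fun (`]tau, 1]%classic : set R) (EFin \o f2).
  by apply: measurable_funS mf2 => //; exact: subset_itv_oc_cc.
apply/integrableP; split.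
  rewrite I01; apply/measurable_funU => //; split.
    apply: eq_measurable_fun mf1 => t; rewrite inE/= in_itv/= => h.
    by rewrite ff1.
  apply: eq_measurable_fun mf2' => t; rewrite inE/= in_itv/= => h.
  by rewrite ff2.
have m1 : measurable_fun (`[0, tau]%classic : set R) (fun t => `|(f1 t)%:E|)%E.
  exact: measurableT_comp.
have m2 : measurable_fun (`[tau, 1]%classic : set R) (fun t => `|(f2 t)%:E|)%E.
  exact: measurableT_comp.
have [t h|t h|||_ ->] := @ge0_integral_split (fun t => `|(f t)%:E|)%E
  (fun t => `|(f1 t)%:E|)%E (fun t => `|(f2 t)%:E|)%E _ _ m1 m2 _ _ => //.
- by rewrite ff1.
- by rewrite ff2.
by rewrite lte_add_pinfty.
Qed.

Lemma Rintegral_split (f f1 f2 : R -> R) :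
  (forall t, 0 <= t <= tau -> f t = f1 t) ->
  (forall t, tau < t <= 1 -> f t = f2 t) ->
  mu.-integrable `[0, tau] (EFin \o f1) ->
  mu.-integrable `[tau, 1] (EFin \o f2) ->
  \int[mu]_(t in `[0, 1]) f t =
  \int[mu]_(t in `[0, tau]) f1 t + \int[mu]_(t in `[tau, 1]) f2 t.
Proof.
move=> ff1 ff2 i1 i2; have fi := integrable_split ff1 ff2 i1 i2.
have i2' : mu.-integrable `]tau, 1] (EFin \o f2).
  by apply: integrableS i2 => //; exact: subset_itv_oc_cc.
rewrite I01 in fi *; rewrite Rintegral_setU//; congr (_ + _).
  by apply: eq_Rintegral => t; rewrite inE/= in_itv/= => h; rewrite ff1.
rewrite -Rintegral_itv_obnd_cbnd//.
by apply: eq_Rintegral => t; rewrite inE/= in_itv/= => h; rewrite ff2.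
Qed.

End split_integrals.

Section gluing.
Context {R : realType} {X : finType} (Q : X -> X -> R) (L : R * R -> R).
Hypothesis hL : admissible_mean L.
Hypothesis Q_ge0 : forall x y, 0 <= Q x y.
Notation mu := (@lebesgue_measure R).
Implicit Types (m : R -> X -> R) (V : R -> X -> X -> R) (nu : X -> R).

(** The inverse of [t |-> a + c * t]. *)
Definition unscale (a c t : R) : R := - a / c + c^-1 * t.

Section piece.
Variables (a c : R).
Hypothesis c0 : 0 < c.

Let D : set R := `[a, a + c]%classic.

Let mD : measurable D. Proof. exact: measurable_itv. Qed.

Let cN0 : c != 0. Proof. exact: lt0r_neq0. Qed.

Let unscaleK t : unscale a c (a + c * t) = t.
Proof. by rewrite /unscale; field. Qed.

Let preimD : (fun t => a + c * t) @^-1` D = `[0, 1]%classic.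
Proof.
apply/seteqP; split => t /=; rewrite /D /= !in_itv/=;
  by rewrite lerD2l ger_pMr// lerDl pmulr_rge0.
Qed.

Let preim01 : (fun t => - a / c + c^-1 * t) @^-1` `[0, 1]%classic = D.
Proof.
have H t : (0 <= - a / c + c^-1 * t <= 1) = (a <= t <= a + c).
  rewrite [c^-1 * t]mulrC -mulrDl ler_pdivlMr// ler_pdivrMr// mul0r mul1r.
  by rewrite addrC subr_ge0 lerBlDl.
by apply/seteqP; split => t /=; rewrite /D /= !in_itv/= H.
Qed.

Lemma integrable_unscale f : mu.-integrable `[0, 1] (EFin \o f) ->
  mu.-integrable D (EFin \o (fun t => f (unscale a c t))).
Proof.
move=> fi; have ci : c^-1 != 0 by rewrite invr_eq0.
have := integrable_affine (- a / c) ci (measurable_itv _) fi.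
by rewrite preim01.
Qed.

(** The boundary form of the continuity equation for a curve squeezed into
    the time interval [a, a + c]: the speed is divided by [c], and so is the flux. *)
Lemma piece_boundary nu0 nu1 m V x phi : CE1 nu0 nu1 m V -> smooth phi ->
  \int[mu]_(t in D) (derive1 phi t * m (unscale a c t) x) =
  phi (a + c) * nu1 x - phi a * nu0 x +
  \int[mu]_(t in D) (phi t *
     outflow (fun y z => c^-1 * V (unscale a c t) y z) x).
Proof.
move=> h sphi; pose chi t := phi (a + c * t).
have schi : smooth chi by exact: smooth_comp_affine.
have mi : mu.-integrable `[0, 1] (EFin \o (fun t => m t x)).
  by apply: integrable_within_continuous; exact: CE1_within h.
have oi : mu.-integrable `[0, 1] (EFin \o (fun t => outflow (V t) x)).
  by apply: integrable_outflow => y z; exact: CE1_integrable h.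
rewrite (Rintegral_affine a cN0 mD); last first.
  apply: (@integrable_continuousM _ _ _ (derive1 phi)).
    exact: (smooth_continuous (smooth_derive sphi)).
  exact: (integrable_unscale mi).
under [X in _ = _ + X]eq_Rintegral do rewrite outflowZ mulrCA.
rewrite [X in _ = _ + X]RintegralZl//; last first.
  apply: (@integrable_continuousM _ _ _ phi); first exact: (smooth_continuous sphi).
  exact: (integrable_unscale oi).
rewrite [X in _ = _ + _ * X](Rintegral_affine a cN0 mD); last first.
  apply: (@integrable_continuousM _ _ _ phi); first exact: (smooth_continuous sphi).
  exact: (integrable_unscale oi).
rewrite preimD gtr0_norm// mulrA mulVf// mul1r.
have -> : \int[mu]_(t in `[0, 1])
     (phi (a + c * t) * outflow (V (unscale a c (a + c * t))) x) =
   \int[mu]_(t in `[0, 1]) (phi (a + c * t) * outflow (V t) x).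
  by apply: eq_Rintegral => t _; rewrite unscaleK.
have -> : \int[mu]_(t in `[0, 1])
     (derive1 phi (a + c * t) * m (unscale a c (a + c * t)) x) =
   \int[mu]_(t in `[0, 1]) (derive1 phi (a + c * t) * m t x).
  by apply: eq_Rintegral => t _; rewrite unscaleK.
have := CE1_boundary x h schi; rewrite /chi mulr1 mulr0 addr0 => <-.
rewrite -RintegralZl//; last first.
  apply: (@integrable_continuousM _ _ _ (fun t => derive1 phi (a + c * t))) mi.
  exact/smooth_continuous/smooth_comp_affine/smooth_derive.
apply: eq_Rintegral => t _.
by rewrite derive1_comp_affine// mulrA [c * _]mulrC.
Qed.

(** The action is quadratic in the flux, which is divided by [c], and the length of
    the time interval is [c]; hence one factor [c^-1] remains. *)
Lemma piece_energy nu0 nu1 m V : CE1 nu0 nu1 m V ->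
  measurable_fun D (fun t => action Q L (m (unscale a c t))
    (fun y z => c^-1 * V (unscale a c t) y z)) /\
  (\int[mu]_(t in D) action Q L (m (unscale a c t))
     (fun y z => (c^-1 * V (unscale a c t) y z)%R)
   = c^-1%:E * \int[mu]_(t in `[0%R, 1%R]) action Q L (m t) (V t))%E.
Proof.
move=> h; have mA := CE1_measurable_action hL Q_ge0 h.
have ci : c^-1 != 0 by rewrite invr_eq0.
have mAc : measurable_fun (`[0, 1]%classic : set R)
    (fun t => action Q L (m t) (fun y z => c^-1 * V t y z)).
  apply: (@eq_measurable_fun _ _ _ _ _
    (fun t => (c^-1 ^+ 2)%:E * action Q L (m t) (V t))%E).
    by move=> t _; rewrite actionZ.
  exact: measurable_funeM.
have mAD : measurable_fun D (fun t => action Q L (m (unscale a c t))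
    (fun y z => c^-1 * V (unscale a c t) y z)).
  apply: (@measurable_comp _ _ _ _ _ _ (`[0, 1]%classic : set R)
    (fun t => action Q L (m t) (fun y z => c^-1 * V t y z)) _ (unscale a c)) => //.
  - by move=> _ [t Dt <-]; rewrite -preim01 in Dt.
  - apply: measurable_funTS; apply: continuous_measurable_fun.
    exact: (smooth_continuous (@smooth_affine R (- a / c) c^-1)).
split => //.
rewrite (ge0_integral_affine a cN0 mD mAD); last by move=> t _; exact: action_ge0.
rewrite preimD gtr0_norm//.
have -> : (\int[mu]_(t in `[0%R, 1%R]) action Q L (m (unscale a c (a + c * t)))
      (fun y z => (c^-1 * V (unscale a c (a + c * t)) y z)%R) =
    (c^-1 ^+ 2)%:E * \int[mu]_(t in `[0%R, 1%R]) action Q L (m t) (V t))%E.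
  rewrite -ge0_integralZl//; last 2 first.
  - by move=> t _; exact: action_ge0.
  - by rewrite lee_fin sqr_ge0.
  by apply: eq_integral => t _; rewrite unscaleK actionZ.
by rewrite muleA -EFinM expr2 mulrA mulfV// mul1r.
Qed.

Lemma within_continuous_unscale (f : R -> R) : {within `[0, 1], continuous f} ->
  {within D, continuous (fun t => f (unscale a c t))}.
Proof.
move=> cf; apply: (@within_continuous_affine _ `[0, 1]%classic D f) => //.
by move=> t; rewrite -preim01.
Qed.

Lemma unscale01 t : a <= t <= a + c -> 0 <= unscale a c t <= 1.
Proof.
move=> h; have : D t by rewrite /D /= in_itv.
by rewrite -preim01 /= in_itv.
Qed.

End piece.

Definition glue (T : Type) (tau : R) (f1 f2 : R -> T) (t : R) : T :=
  if t <= tau then f1 (unscale 0 tau t) else f2 (unscale tau (1 - tau) t).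

Lemma test_function_endpoints (phi : R -> R) : test_function phi ->
  phi 0 = 0 /\ phi 1 = 0.
Proof.
move=> [_ [u [v [u0 v1 phi0]]]]; split; apply: phi0; rewrite in_itv/=.
  by rewrite negb_and -ltNge u0.
by rewrite negb_and -!ltNge v1 orbT.
Qed.

Section glue.
Variables (tau : R) (nu0 nu1 nu2 : X -> R) (m m' : R -> X -> R)
  (V V' : R -> X -> X -> R).
Hypotheses (tau01 : 0 < tau < 1) (h : CE1 nu0 nu1 m V) (h' : CE1 nu1 nu2 m' V').

Let tau0 : 0 < tau. Proof. by case/andP: tau01. Qed.

Let tau1 : 0 < 1 - tau. Proof. by rewrite subr_gt0; case/andP: tau01. Qed.

Let end1 : 0 + tau = tau. Proof. exact: add0r. Qed.

Let end2 : tau + (1 - tau) = 1. Proof. by rewrite addrC subrK. Qed.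

Let glued := glue tau m m'.

Let gluedV := glue tau (fun t x y => tau^-1 * V t x y)
  (fun t x y => (1 - tau)^-1 * V' t x y).

Let glue1 T (f1 f2 : R -> T) t : 0 <= t <= tau ->
  glue tau f1 f2 t = f1 (unscale 0 tau t).
Proof. by case/andP=> _ tt; rewrite /glue tt. Qed.

Let glue2 T (f1 f2 : R -> T) t : tau < t <= 1 ->
  glue tau f1 f2 t = f2 (unscale tau (1 - tau) t).
Proof. by case/andP=> tt _; rewrite /glue leNgt tt. Qed.

Let glued2 t : tau <= t <= 1 -> glued t = m' (unscale tau (1 - tau) t).
Proof.
case/andP; rewrite le_eqVlt => /predU1P[<- _|tt t1]; last by rewrite /glued glue2// tt.
rewrite /glued glue1 ?lexx ?ltW//.
rewrite (_ : unscale 0 tau tau = 1); last by rewrite /unscale; field; exact: lt0r_neq0.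
rewrite (_ : unscale _ _ tau = 0); last by rewrite /unscale; field; exact: lt0r_neq0.
by rewrite (ce_end h) (ce_start h').
Qed.

(** In the sum of the two boundary formulas the terms at time [tau] cancel, because
    the first curve ends where the second one starts. *)
Lemma CE1_glue : CE1 nu0 nu2 glued gluedV.
Proof.
have Vi1 x y : mu.-integrable `[0, tau]
    (EFin \o (fun t => tau^-1 * V (unscale 0 tau t) x y)).
  have := integrable_unscale 0 tau0 (CE1_integrable x y h).
  by rewrite end1 => Vi; exact: (integrableZl _ tau^-1 Vi).
have Vi2 x y : mu.-integrable `[tau, 1]
    (EFin \o (fun t => (1 - tau)^-1 * V' (unscale tau (1 - tau) t) x y)).
  have := integrable_unscale tau tau1 (CE1_integrable x y h').
  by rewrite end2 => Vi; exact: (integrableZl _ (1 - tau)^-1 Vi).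
have cm1 x : {within `[0, tau], continuous (fun t => m (unscale 0 tau t) x)}.
  by have := @within_continuous_unscale 0 tau tau0 _ (CE1_within (x := x) h);
    rewrite end1.
have cm2 x : {within `[tau, 1],
    continuous (fun t => m' (unscale tau (1 - tau) t) x)}.
  by have := @within_continuous_unscale tau (1 - tau) tau1 _ (CE1_within (x := x) h');
    rewrite end2.
split.
- move=> t /andP[t0 t1]; have [tt|tt] := leP t tau.
    rewrite /glued glue1 ?t0//; apply: (ce_prob h).
    by apply: unscale01 => //; rewrite end1 t0.
  rewrite /glued glue2 ?tt//; apply: (ce_prob h').
  by apply: unscale01 => //; rewrite end2 (ltW tt).
- move=> x.
  have -> : `[0, 1]%classic = `[0, tau]%classic `|` `[tau, 1]%classic :> set R.
    apply/seteqP; split => t /=; rewrite !in_itv/=.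
      by move=> /andP[-> ->]; rewrite andbT; case: (leP t tau) => tt;
        [left|right; exact: ltW].
    case/andP: tau01 => t0 t1.
    by move=> [|] /andP[? ?]; apply/andP; split; lra.
  apply: withinU_continuous; [exact: itv_closed|exact: itv_closed| |].
    apply: subspace_eq_continuous (cm1 x) => t; rewrite inE/= in_itv/= => tt.
    by rewrite /from_subspace /glued /= glue1.
  apply: subspace_eq_continuous (cm2 x) => t; rewrite inE/= in_itv/= => tt.
  by rewrite /from_subspace/= glued2.
- move=> x y; apply: integrable_loc_integrable.
  apply: (integrable_split tau01 _ _ (Vi1 x y) (Vi2 x y)) => t tt.
    by rewrite /gluedV /= glue1.
  by rewrite /gluedV /= glue2.
- rewrite /glued glue1 ?lexx ?ltW// /unscale oppr0 mul0r mulr0 addr0.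
  exact: (ce_start h).
- rewrite glued2 ?lexx ?andbT; last by case/andP: tau01 => _ /ltW.
  rewrite (_ : unscale _ _ 1 = 1); first exact: (ce_end h').
  by rewrite /unscale; field; exact: lt0r_neq0.
- move=> x phi tphi; have sphi := test_function_smooth tphi.
  have [phi0 phi1] := test_function_endpoints tphi.
  have cphi := smooth_continuous sphi.
  have cphi' := smooth_continuous (smooth_derive sphi).
  have oi1 : mu.-integrable `[0, tau]
      (EFin \o (fun t => outflow (fun y z => tau^-1 * V (unscale 0 tau t) y z) x)).
    have Vi y z : mu.-integrable `[0, 1] (EFin \o (fun t => tau^-1 * V t y z)).
      exact: (integrableZl _ tau^-1 (CE1_integrable y z h)).
    have := integrable_unscale 0 tau0 (@integrable_outflow _ _
      (fun t y z => tau^-1 * V t y z) x Vi).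
    by rewrite end1.
  have oi2 : mu.-integrable `[tau, 1]
      (EFin \o (fun t => outflow (fun y z =>
         (1 - tau)^-1 * V' (unscale tau (1 - tau) t) y z) x)).
    have Vi y z : mu.-integrable `[0, 1]
        (EFin \o (fun t => (1 - tau)^-1 * V' t y z)).
      exact: (integrableZl _ (1 - tau)^-1 (CE1_integrable y z h')).
    have := integrable_unscale tau tau1 (@integrable_outflow _ _
      (fun t y z => (1 - tau)^-1 * V' t y z) x Vi).
    by rewrite end2.
  have -> : \int[mu]_(t in `[0, 1]) (derive1 phi t * glued t x) =
     \int[mu]_(t in `[0, tau]) (derive1 phi t * m (unscale 0 tau t) x) +
     \int[mu]_(t in `[tau, 1]) (derive1 phi t * m' (unscale tau (1 - tau) t) x).
    apply: (Rintegral_split tau01) => [t tt|t tt||].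
    + by rewrite /glued /= glue1.
    + by rewrite /glued /= glue2.
    + by apply: integrable_continuousM => //; exact: integrable_within_continuous.
    + by apply: integrable_continuousM => //; exact: integrable_within_continuous.
  have -> : \int[mu]_(t in `[0, 1]) (phi t * (2^-1 *
        \sum_y (gluedV t x y - gluedV t y x))) =
     \int[mu]_(t in `[0, tau]) (phi t *
        outflow (fun y z => tau^-1 * V (unscale 0 tau t) y z) x) +
     \int[mu]_(t in `[tau, 1]) (phi t *
        outflow (fun y z => (1 - tau)^-1 * V' (unscale tau (1 - tau) t) y z) x).
    apply: (Rintegral_split tau01) => [t tt|t tt||].
    + by rewrite /gluedV /= glue1.
    + by rewrite /gluedV /= glue2.
    + exact: integrable_continuousM.
    + exact: integrable_continuousM.
  have := piece_boundary 0 tau0 x h sphi; rewrite end1 => ->.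
  have := piece_boundary tau tau1 x h' sphi; rewrite end2 => ->.
  by rewrite phi0 phi1; ring.
Qed.

Lemma energy_glue :
  (\int[mu]_(t in `[0%R, 1%R]) action Q L (glued t) (gluedV t)
   = tau^-1%:E * \int[mu]_(t in `[0%R, 1%R]) action Q L (m t) (V t) +
     (1 - tau)^-1%:E * \int[mu]_(t in `[0%R, 1%R]) action Q L (m' t) (V' t))%E.
Proof.
have := piece_energy 0 tau0 h; rewrite end1 => -[ma1 <-].
have := piece_energy tau tau1 h'; rewrite end2 => -[ma2 <-].
have eq1 t : 0 <= t <= tau -> action Q L (glued t) (gluedV t) =
    action Q L (m (unscale 0 tau t)) (fun y z => tau^-1 * V (unscale 0 tau t) y z).
  by move=> tt; rewrite /glued /gluedV !glue1.
have eq2 t : tau < t <= 1 -> action Q L (glued t) (gluedV t) =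
    action Q L (m' (unscale tau (1 - tau) t))
      (fun y z => (1 - tau)^-1 * V' (unscale tau (1 - tau) t) y z).
  by move=> tt; rewrite /glued /gluedV !glue2.
have [_ E] := ge0_integral_split tau01 eq1 eq2 ma1 ma2
  (fun=> action_ge0 Q hL _ _) (fun=> action_ge0 Q hL _ _).
exact: E.
Qed.

End glue.

Local Notation W := (transport_dist Q L).

Lemma transport_dist_lt nu0 nu1 r : 0 < r -> (W nu0 nu1 < r%:E)%E ->
  exists m V, CE1 nu0 nu1 m V /\
    (\int[mu]_(t in `[0%R, 1%R]) action Q L (m t) (V t) < (r ^+ 2)%:E)%E.
Proof.
move=> r0 /ereal_inf_lt[_ [m [V [h ->]]] zr]; exists m, V; split => //.
rewrite ltNge; apply/negP => Ir; move: zr; rewrite ltNge => /negP; apply.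
have -> : r%:E = sqrte (r ^+ 2)%:E :> \bar R.
  by rewrite /= sqrtr_sqr gtr0_norm.
rewrite lee_sqrt//; apply: integral_ge0 => t _; exact: action_ge0.
Qed.

Lemma transport_dist_le nu0 nu1 m V r : CE1 nu0 nu1 m V -> 0 <= r ->
  (\int[mu]_(t in `[0%R, 1%R]) action Q L (m t) (V t) <= (r ^+ 2)%:E)%E ->
  (W nu0 nu1 <= r%:E)%E.
Proof.
move=> h r0 Ir; apply: ge_ereal_inf.
exists (sqrte (\int[mu]_(t in `[0%R, 1%R]) action Q L (m t) (V t))%E).
  by exists m, V.
have -> : r%:E = sqrte (r ^+ 2)%:E :> \bar R by rewrite /= sqrtr_sqr ger0_norm.
by rewrite lee_sqrt// lee_fin sqr_ge0.
Qed.

Lemma transport_dist_ge0 nu0 nu1 : (0 <= W nu0 nu1)%E.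
Proof. by apply: le_ereal_inf_tmp => _ [m [V [_ ->]]]; exact: sqrte_ge0. Qed.

(** The gluing time proportional to [r] is the one that minimises
    [r ^+ 2 / tau + r' ^+ 2 / (1 - tau)], with minimum [(r + r') ^+ 2]. *)
Lemma transport_dist_triangle_lt nu0 nu1 nu2 (r r' : R) : 0 < r -> 0 < r' ->
  (W nu0 nu1 < r%:E)%E -> (W nu1 nu2 < r'%:E)%E ->
  (W nu0 nu2 <= (r + r')%:E)%E.
Proof.
move=> r0 r'0 /(transport_dist_lt r0)[m [V [h E]]].
move=> /(transport_dist_lt r'0)[m' [V' [h' E']]].
have rr : 0 < r + r' by rewrite addr_gt0.
pose tau := r / (r + r').
have tau01 : 0 < tau < 1 by rewrite divr_gt0// ltr_pdivrMr// mul1r ltrDl.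
apply: (transport_dist_le (CE1_glue tau01 h h')); first exact: ltW.
rewrite (energy_glue tau01 h h').
have -> : (r + r') ^+ 2 = tau^-1 * r ^+ 2 + (1 - tau)^-1 * r' ^+ 2.
  have -> : 1 - tau = r' / (r + r') by rewrite /tau; field; exact: lt0r_neq0.
  by rewrite /tau; field; rewrite !lt0r_neq0.
rewrite EFinD !EFinM; apply: leeD; apply: lee_wpmul2l; rewrite ?lee_fin ?invr_ge0;
  try exact: ltW.
  by case/andP: tau01 => /ltW.
by case/andP: tau01 => _ /ltW; rewrite subr_ge0.
Qed.

End gluing.

(** * The distance of nearby measures *)

Section unit_flows.
Context {R : realType} {X : finType} (Q : X -> X -> R).

(** Flows along the edges of a path from [x0] to [z] carry a unit of mass from [x0] to
    [z]. The factor [2] below compensates the factor [2^-1] in [outflow]. *)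
Lemma unit_flow_exists x0 z : connect [rel u v | 0 < Q u v] x0 z ->
  exists U : X -> X -> R, (forall x y, Q x y = 0 -> U x y = 0) /\
    forall x, outflow U x = (x == x0)%:R - (x == z)%:R.
Proof.
move=> /connectP[q + ->]; elim: q x0 => [|y q ih] x0 /=.
  move=> _; exists (fun _ _ => 0); split => // x.
  by rewrite outflow0 subrr.
move=> /andP[Qxy /ih[U [UQ Uo]]].
exists (fun u v => U u v + 2 * ((u == x0) && (v == y))%:R); split.
  move=> u v Quv; rewrite UQ// add0r.
  case: andP => [[/eqP ux /eqP vy]|_]; last by rewrite mulr0.
  by move: Qxy; rewrite -ux -vy Quv ltxx.
move=> x; rewrite (@outflowD _ _ U) Uo.
have -> : outflow (fun u v => 2 * ((u == x0) && (v == y))%:R) x =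
    (x == x0)%:R - (x == y)%:R :> R.
  rewrite outflowZ /outflow mulrA divff ?pnatr_eq0// mul1r big_split/= sumrN.
  congr (_ - _).
    rewrite (bigD1 y)//= eqxx andbT big1 ?addr0// => w /negbTE ->.
    by rewrite andbF.
  rewrite (bigD1 x0)//= eqxx big1 ?addr0// => w /negbTE ->.
  by [].
by rewrite addrC addrA subrK.
Qed.

End unit_flows.

Section smooth_profile.
Context {R : realType}.

(** The profile of the detour. Near its zeros [0] and [1] it decays like the square
    of the distance, so that the squared derivative is bounded by a multiple of
    the function itself; this keeps the quotient of squared speed and mass
    bounded. *)
Definition bump (t : R) : R := (t * (1 - t)) ^+ 2.

(** The profile of the motion from one measure to the other. Its derivative
    [6 * t * (1 - t)] vanishes at the ends like the square root of [bump], for the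
    same reason. *)
Definition ramp (t : R) : R := t ^+ 2 * (3 - 2 * t).

Let lin (a c : R) t := a + c * t.

Let bumpE : bump = (lin 0 1 \* lin 1 (-1)) \* (lin 0 1 \* lin 1 (-1)).
Proof. by apply/funext => t; rewrite /bump /lin/=; ring. Qed.

Let rampE : ramp = (lin 0 1 \* lin 0 1) \* lin 3 (-2).
Proof. by apply/funext => t; rewrite /ramp /lin/=; ring. Qed.

Let smooth_lin a c : smooth (lin a c). Proof. exact: smooth_affine. Qed.

Let derive1_lin a c : derive1 (lin a c) = cst c.
Proof. exact: derive1_affine. Qed.

Lemma smooth_bump : smooth bump.
Proof. by rewrite bumpE; do 2 apply: smoothM => //; apply: smoothM. Qed.

Lemma smooth_ramp : smooth ramp.
Proof. by rewrite rampE; do 2 apply: smoothM => //. Qed.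

Lemma derive1_bump t : derive1 bump t = 2 * (t * (1 - t)) * (1 - 2 * t).
Proof.
rewrite bumpE smooth_derive1M; [|exact: smoothM..].
by rewrite /= smooth_derive1M// /= !derive1_lin /= /lin; ring.
Qed.

Lemma derive1_ramp t : derive1 ramp t = 6 * (t * (1 - t)).
Proof.
rewrite rampE smooth_derive1M//; last exact: smoothM.
by rewrite /= smooth_derive1M// /= !derive1_lin /= /lin; ring.
Qed.

Lemma bump_itv t : 0 <= t <= 1 -> 0 <= bump t <= 1.
Proof.
move=> /andP[t0 t1]; rewrite sqr_ge0 exprn_ile1// ?mulr_ge0 ?subr_ge0//.
by rewrite mulr_ile1 ?subr_ge0// gerBl.
Qed.

Lemma ramp_itv t : 0 <= t <= 1 -> 0 <= ramp t <= 1.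
Proof.
move=> /andP[t0 t1]; apply/andP; split.
  by rewrite mulr_ge0 ?sqr_ge0//; lra.
have -> : ramp t = 1 - (1 - t) ^+ 2 * (1 + 2 * t) by rewrite /ramp; ring.
by rewrite gerBl mulr_ge0 ?sqr_ge0//; lra.
Qed.

End smooth_profile.

Section detour.
Context {R : realType} {X : finType} (Q : X -> X -> R) (p : X -> R)
  (L : R * R -> R).
Hypotheses (hQ : markov_triple Q p) (hL : admissible_mean L).
Notation mu := (@lebesgue_measure R).

Let Q_ge0 : forall x y, 0 <= Q x y := rate_ge0 hQ.

Let rev0 x y : Q x y = 0 -> Q y x = 0.
Proof.
move=> Q0; apply: (@mulfI _ (p y)); first by rewrite gt_eqF// (stat_gt0 hQ).
by rewrite mulr0 -(stat_reversible hQ) Q0 mulr0.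
Qed.

Lemma prob_le1 (m : X -> R) x : prob m -> m x <= 1.
Proof.
move=> [m0 <-]; rewrite (bigD1 x)//= lerDl.
exact: sumr_ge0.
Qed.

(** The unit flows [U z] from a root [x0] to all vertices [z] convert any velocity of
    total mass [0] into a flux along the edges, linearly. *)
Variables (x0 : X) (U : X -> X -> X -> R).
Hypothesis U0 : forall z x y, Q x y = 0 -> U z x y = 0.
Hypothesis Uout : forall z x, outflow (U z) x = (x == x0)%:R - (x == z)%:R.

Variables (nu0 nu1 : X -> R) (d : R).
Hypotheses (pnu0 : prob nu0) (pnu1 : prob nu1) (d0 : 0 < d) (d1 : d <= 1).
Hypothesis dnu : forall x, `|nu1 x - nu0 x| <= d.

Let base t x := (1 - ramp t) * nu0 x + ramp t * nu1 x.

(** A fraction [d * bump t] of the mass is temporarily replaced by the stationary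
    measure, which bounds all masses below by a multiple of [d * bump t]. *)
Definition detour t x := (1 - d * bump t) * base t x + d * bump t * p x.

Let velocity t x := derive1 (detour ^~ x) t.

Definition detour_flow t x y := \sum_z velocity t z * U z x y.

Let smooth_cstDZ (f : R -> R) a b : smooth f ->
  smooth (cst a \+ (cst b \* f)).
Proof.
by move=> sf; apply: smoothD; [|apply: smoothM => //]; exact: smooth_cst.
Qed.

Let detourE x : detour ^~ x = ((cst 1 \+ (cst (- d) \* bump)) \*
   (cst (nu0 x) \+ (cst (nu1 x - nu0 x) \* ramp))) \+
   (cst 0 \+ (cst (d * p x) \* bump)).
Proof. by apply/funext => t; rewrite /detour /base/=; ring. Qed.

Let smooth_detour x : smooth (detour ^~ x).
Proof.
have sb := @smooth_bump R; have sr := @smooth_ramp R.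
rewrite detourE; apply: smoothD; last exact: smooth_cstDZ.
by apply: smoothM; exact: smooth_cstDZ.
Qed.

Let derive1_cstDZ (f : R -> R) a b : smooth f ->
  derive1 (cst a \+ (cst b \* f)) = cst b \* derive1 f.
Proof.
move=> sf; apply/funext => t; rewrite (_ : _ \+ _ = (fun s => a + b * s) \o f)//.
rewrite derive1_comp ?derive1_affine//; last exact: smooth_derivable.
Qed.

Let velocityE t x : velocity t x =
  (1 - d * bump t) * (6 * (t * (1 - t)) * (nu1 x - nu0 x)) +
  d * (2 * (t * (1 - t)) * (1 - 2 * t)) * (p x - base t x).
Proof.
rewrite /velocity detourE.
have sb := @smooth_bump R; have sr := @smooth_ramp R.
have s1 := smooth_cstDZ 1 (- d) sb.
have s2 := smooth_cstDZ (nu0 x) (nu1 x - nu0 x) sr.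
rewrite smooth_derive1D; [|exact: smoothM|exact: smooth_cstDZ].
rewrite /= smooth_derive1M// /= !derive1_cstDZ//= derive1_bump derive1_ramp /base.
ring.
Qed.

Let sum_base t : \sum_x base t x = 1.
Proof.
rewrite big_split/= -!mulr_sumr (proj2 pnu0) (proj2 pnu1); ring.
Qed.

Let sum_velocity t : \sum_x velocity t x = 0.
Proof.
under eq_bigr do rewrite velocityE.
rewrite big_split/= -!mulr_sumr !sumrB sum_base.
rewrite (proj2 pnu0) (proj2 pnu1) (proj2 (stat_prob hQ)); ring.
Qed.

(** The sign: [U z] brings mass from the root to [z], and what leaves the root in
    total is the sum of the velocities, which is [0]. *)
Let outflow_detour t x : outflow (detour_flow t) x = - velocity t x.
Proof.
rewrite /detour_flow (@outflow_sum _ _ _ _ (fun z x y => velocity t z * U z x y)).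
under eq_bigr do rewrite outflowZ Uout mulrBr.
rewrite sumrB -mulr_suml sum_velocity mul0r sub0r; congr (- _).
rewrite (bigD1 x)//= eqxx mulr1 big1 ?addr0// => z zx.
by rewrite eq_sym (negbTE zx) mulr0.
Qed.

Let base_itv t x : 0 <= t <= 1 -> 0 <= base t x <= 1.
Proof.
move=> /ramp_itv/andP[r0 r1].
have n0 := proj1 pnu0 x; have n1 := proj1 pnu1 x.
have m0 := prob_le1 x pnu0; have m1 := prob_le1 x pnu1.
rewrite /base; apply/andP; split;
  first by apply: addr_ge0; apply: mulr_ge0; rewrite ?subr_ge0.
rewrite -[leRHS](subrK (ramp t)); apply: lerD; first by rewrite ler_piMr ?subr_ge0.
by rewrite ler_piMr.
Qed.

Let dbump_itv t : 0 <= t <= 1 -> 0 <= d * bump t <= 1.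
Proof.
move=> /bump_itv/andP[b0 b1].
by rewrite mulr_ge0 ?(ltW d0)//= mulr_ile1// ltW.
Qed.

(** Both contributions to the velocity are of size [d * sqrt (bump t)]: the motion
    because the measures are [d]-close, the detour because of its amplitude. *)
Let velocity_le t x : 0 <= t <= 1 -> `|velocity t x| <= 8 * d * (t * (1 - t)).
Proof.
move=> t01; have /andP[t0 t1] := t01.
have u0 : 0 <= t * (1 - t) by rewrite mulr_ge0 ?subr_ge0.
have /andP[b0 b1] := dbump_itv t01.
have /andP[c0 c1] := base_itv x t01.
have p0 := ltW (stat_gt0 hQ x); have p1 := prob_le1 x (stat_prob hQ).
rewrite velocityE (le_trans (ler_normD _ _))//.
have -> : 8 * d * (t * (1 - t)) =
  1 * (6 * (t * (1 - t)) * d) + d * (2 * (t * (1 - t)) * 1) * 1 by ring.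
have n1 : `|1 - d * bump t| <= 1 by rewrite ler_norml; lra.
have n2 : `|1 - 2 * t| <= 1 by rewrite ler_norml; lra.
have n3 : `|p x - base t x| <= 1 by rewrite ler_norml; lra.
apply: lerD; rewrite normrM; apply: ler_pM => //.
  by rewrite normrM ger0_norm ?mulr_ge0 ?subr_ge0// ler_wpM2l ?mulr_ge0 ?subr_ge0.
by rewrite normrM (gtr0_norm d0) ler_pM2l// normrM ger0_norm ?mulr_ge0 ?subr_ge0//
  ler_wpM2l ?mulr_ge0 ?subr_ge0.
Qed.

Let detour_ge t x : 0 <= t <= 1 -> d * bump t * p x <= detour t x.
Proof.
move=> t01; rewrite /detour lerDr mulr_ge0//.
  by rewrite subr_ge0; case/andP: (dbump_itv t01).
by case/andP: (base_itv x t01).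
Qed.

Let prob_detour t : 0 <= t <= 1 -> prob (detour t).
Proof.
move=> t01; split => [x|].
  apply: le_trans (detour_ge x t01); apply: mulr_ge0.
    by case/andP: (dbump_itv t01).
  exact: ltW (stat_gt0 hQ x).
rewrite big_split/= -!mulr_sumr sum_base (proj2 (stat_prob hQ)); ring.
Qed.

Lemma CE1_detour : CE1 nu0 nu1 detour detour_flow.
Proof.
have cv x : continuous (velocity ^~ x).
  exact: (smooth_continuous (smooth_derive (smooth_detour x))).
have cd x : continuous (detour ^~ x) by exact: smooth_continuous.
split.
- exact: prob_detour.
- by move=> x; exact: continuous_subspaceT.
- move=> x y; apply: integrable_loc_integrable.
  apply: integrable_within_continuous; apply: continuous_subspaceT.
  rewrite /detour_flow; elim: (index_enum X) => [|z r ih] t.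
    by under eq_fun do rewrite big_nil; exact: cvg_cst.
  under eq_fun do rewrite big_cons.
  by apply: cvgD; [apply: cvgM; [exact: cv|exact: cvg_cst]|exact: ih].
- apply/funext => x; rewrite /detour /base /bump /ramp; ring.
- apply/funext => x; rewrite /detour /base /bump /ramp; ring.
- move=> x phi tphi; have sphi := test_function_smooth tphi.
  have [phi0 phi1] := test_function_endpoints tphi.
  have i1 : mu.-integrable `[0, 1] (EFin \o (fun t => derive1 phi t * detour t x)).
    apply: integrable_continuousM;
      first exact: (smooth_continuous (smooth_derive sphi)).
    by apply: integrable_within_continuous; exact: continuous_subspaceT.
  have i2 : mu.-integrable `[0, 1] (EFin \o (fun t => phi t * velocity t x)).
    apply: integrable_continuousM; first exact: (smooth_continuous sphi).
    by apply: integrable_within_continuous; exact: continuous_subspaceT.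
  have : \int[mu]_(t in `[0, 1]) derive1 (phi \* (detour ^~ x)) t = 0.
    rewrite smooth_FTC2//; last exact: smoothM.
    by rewrite /= phi0 phi1 !mul0r subrr.
  rewrite smooth_derive1M//= RintegralD// => E.
  have -> : \int[mu]_(t in `[0, 1]) (phi t *
      (2^-1 * \sum_y (detour_flow t x y - detour_flow t y x))) =
      - (\int[mu]_(t in `[0, 1]) (phi t * velocity t x)).
    rewrite -mulN1r -RintegralZl//; apply: eq_Rintegral => t _.
    by rewrite -[2^-1 * _]/(outflow (detour_flow t) x) outflow_detour mulrN mulN1r.
  by rewrite -opprD E oppr0.
Qed.

Let U1 x y := \sum_z `|U z x y|.

Let flow_le t x y : 0 <= t <= 1 ->
  `|detour_flow t x y| <= 8 * d * (t * (1 - t)) * U1 x y.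
Proof.
move=> t01; rewrite /detour_flow (le_trans (ler_norm_sum _ _ _))//.
rewrite /U1 mulr_sumr; apply: ler_sum => z _.
by rewrite normrM ler_wpM2r// velocity_le.
Qed.

(** The squared flux is of order [d ^+ 2 * bump t] and the masses are at least of
    order [d * bump t], which leaves one factor [d]. At the ends of the time
    interval masses may vanish, but so does the flux. *)
Let density_le t x y : 0 <= t <= 1 ->
  (action_density L (detour t x * Q x y)%R (detour t y * Q y x)%R
     (detour_flow t x y)
   <= ((8 * U1 x y) ^+ 2 / (p x * Q x y) * d)%:E)%E.
Proof.
move=> t01; have /andP[t0 t1] := t01.
have m0 z : 0 <= detour t z by case: (prob_detour t01).
have [Qxy0|Qxy] := eqVneq (Q x y) 0.
  rewrite Qxy0 (rev0 Qxy0) !mulr0 invr0 mulr0 mul0r.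
  rewrite /detour_flow big1 => [|z _]; last by rewrite U0// mulr0.
  by rewrite action_density0.
have Qxy' : 0 < Q x y by rewrite lt_neqAle eq_sym Qxy Q_ge0.
have px := stat_gt0 hQ x.
have rhs0 : 0 <= (8 * U1 x y) ^+ 2 / (p x * Q x y) * d.
  by rewrite mulr_ge0 ?(ltW d0)// divr_ge0 ?sqr_ge0// mulr_ge0// ltW.
have fl := flow_le x y t01.
have [u0|u0] := eqVneq (t * (1 - t)) 0.
  move: fl; rewrite u0 mulr0 mul0r normr_le0 => /eqP ->.
  by rewrite action_density0 ?mulr_ge0// lee_fin.
have u1 : 0 < t * (1 - t) by rewrite lt_neqAle eq_sym u0 mulr_ge0// subr_ge0.
set u := t * (1 - t) in fl u0 u1 *.
pose k := d * u ^+ 2 * (p x * Q x y).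
have k0 : 0 < k.
  by apply: mulr_gt0; apply: mulr_gt0 => //; exact: exprn_gt0.
have k1 : k <= detour t x * Q x y.
  by rewrite /k mulrA ler_wpM2r// detour_ge.
have k2 : k <= detour t y * Q y x.
  by rewrite /k (stat_reversible hQ) mulrA ler_wpM2r// detour_ge.
apply: le_trans (action_density_antitone hL _ (ltW k0) k1 (ltW k0) k2) _.
have Lk : L (k, k) = k.
  have -> : (k, k) = (k * 1, k * 1) by rewrite mulr1.
  by rewrite (mean_homogeneous hL)// (mean_one hL) mulr1.
rewrite /action_density k0/= lee_fin Lk ler_pdivrMr//.
have -> : (8 * U1 x y) ^+ 2 / (p x * Q x y) * d * k = (8 * d * u * U1 x y) ^+ 2.
  by rewrite /k; field; rewrite gt_eqF//= gt_eqF.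
rewrite -real_normK ?num_real// lerXn2r ?nnegrE//.
apply: mulr_ge0; last exact: sumr_ge0.
by apply: mulr_ge0; [apply: mulr_ge0 => //; exact: ltW|exact: ltW].
Qed.

Definition detour_cost : R :=
  2^-1 * \sum_x \sum_y (8 * U1 x y) ^+ 2 / (p x * Q x y).

Let action_detour_le t : 0 <= t <= 1 ->
  (action Q L (detour t) (detour_flow t) <= (detour_cost * d)%:E)%E.
Proof.
move=> t01; rewrite /action /detour_cost -mulrA EFinM lee_wpmul2l ?lee_fin ?invr_ge0//.
rewrite mulr_suml -sumEFin; apply: lee_sum => x _.
rewrite mulr_suml -sumEFin; apply: lee_sum => y _.
exact: density_le.
Qed.

Lemma transport_dist_detour :
  (transport_dist Q L nu0 nu1 <= (Num.sqrt (detour_cost * d))%:E)%E.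
Proof.
have C0 : 0 <= detour_cost * d.
  rewrite mulr_ge0 ?(ltW d0)// mulr_ge0 ?invr_ge0//.
  apply: sumr_ge0 => x _; apply: sumr_ge0 => y _.
  by rewrite divr_ge0 ?sqr_ge0// mulr_ge0// ltW// (stat_gt0 hQ).
apply: (transport_dist_le CE1_detour); first exact: sqrtr_ge0.
rewrite sqr_sqrtr//.
apply: (@le_trans _ _ (\int[mu]_(t in `[0%R, 1%R]) (detour_cost * d)%:E)%E).
  apply: ge0_le_integral => //.
  - by move=> t _; exact: action_ge0.
  - exact: CE1_measurable_action CE1_detour.
rewrite integral_cst//= lebesgue_measure_itv/= lte_fin ltr01 oppr0 adde0.
by rewrite mule1.
Qed.

End detour.

(** The constant depends only on the unit flows, the rates and the stationary
    measure, since the action of the detour is bounded uniformly in time. *)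
Lemma transport_dist_holder (R : realType) (X : finType) (Q : X -> X -> R)
    (p : X -> R) (L : R * R -> R) :
  markov_triple Q p -> admissible_mean L ->
  exists2 C : R, 0 <= C & forall (nu0 nu1 : X -> R) (d : R),
    prob nu0 -> prob nu1 -> 0 < d <= 1 -> (forall x, `|nu1 x - nu0 x| <= d) ->
    (transport_dist Q L nu0 nu1 <= (Num.sqrt (C * d))%:E)%E.
Proof.
move=> hQ hL.
have [x0 _] : exists x : X, True.
  apply: contrapT => noX; have [_] := stat_prob hQ.
  rewrite big1 => [/esym/eqP|x _]; first by rewrite oner_eq0.
  by exfalso; apply: noX; exists x.
have /choice[U HU] := fun z => unit_flow_exists (rate_irreducible hQ x0 z).
have U0 z x y : Q x y = 0 -> U z x y = 0 by have [+ _] := HU z; apply.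
have Uout z x : outflow (U z) x = (x == x0)%:R - (x == z)%:R by have [] := HU z.
exists (detour_cost Q p U).
  rewrite mulr_ge0 ?invr_ge0//.
  apply: sumr_ge0 => x _; apply: sumr_ge0 => y _.
  by rewrite divr_ge0 ?sqr_ge0// mulr_ge0// ?(rate_ge0 hQ)// ltW// (stat_gt0 hQ).
move=> nu0 nu1 d p0 p1 /andP[d0 d1] dnu.
exact: (transport_dist_detour hQ hL U0 Uout).
Qed.

(** * Push-forward by a retraction *)

Section pushforward.
Context {R : realType} {X : finType} (Q : X -> X -> R) (L : R * R -> R)
  (Y : {set X}) (T : X -> X).
Hypothesis hL : admissible_mean L.
Hypothesis Q_ge0 : forall x y, 0 <= Q x y.
Hypothesis hT : retraction Q Y T.
Notation mu := (@lebesgue_measure R).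
Implicit Types (q : X -> R) (v : X -> X -> R) (m : R -> X -> R)
  (V : R -> X -> X -> R) (nu : X -> R).

Definition push q (y : X) : R := \sum_(x | T x == y) q x.

(** Flux inside a fibre is discarded: it does not contribute to the outflow of the
    fibre, and no rate is available to carry it, since [Q y y = 0]. *)
Definition push_flow v (y y' : X) : R :=
  if y == y' then 0 else \sum_(x | T x == y) \sum_(x' | T x' == y') v x x'.

Lemma push_prob q : prob q -> prob (push q).
Proof.
move=> [q0 q1]; split => [y|]; first by apply: sumr_ge0 => x _.
by rewrite -q1 [RHS](partition_big T predT).
Qed.

Lemma push_notin q y : y \notin Y -> push q y = 0.
Proof.
move=> yY; rewrite /push big_pred0// => x.
apply/negbTE; apply: contra yY => /eqP <-.
by have [+ _ _] := hT; apply.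
Qed.

Lemma push_supported q : {subset support q <= Y} -> push q = q.
Proof.
have [_ TY _] := hT; move=> qY; apply/funext => y.
have [yY|yY] := boolP (y \in Y); last first.
  rewrite push_notin//; apply/esym/eqP; apply: contraNT yY => qy.
  exact: qY.
rewrite /push (bigD1 y)/= ?TY// big1 ?addr0// => x /andP[/eqP Txy xy].
apply/eqP; apply: contraNT xy => /qY xY.
by rewrite -Txy TY.
Qed.

(** The fluxes between points of the same fibre cancel by antisymmetry. *)
Lemma outflow_push v y :
  outflow (push_flow v) y = \sum_(x | T x == y) outflow v x.
Proof.
pose S y y' := \sum_(x | T x == y) \sum_(x' | T x' == y') v x x'.
have -> : outflow (push_flow v) y = 2^-1 * \sum_y' (S y y' - S y' y).
  rewrite /outflow; congr (_ * _); apply: eq_bigr => y' _; rewrite /push_flow eq_sym.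
  by case: eqVneq => [->|//]; rewrite !subrr.
rewrite /outflow -mulr_sumr; congr (_ * _).
rewrite sumrB; under [RHS]eq_bigr do rewrite sumrB.
rewrite sumrB; congr (_ - _).
  rewrite exchange_big/=; apply: eq_bigr => x _.
  by rewrite [RHS](partition_big T predT).
rewrite [RHS]exchange_big/= [RHS](partition_big T predT)//=.
Qed.

(** Subadditivity bounds the density of the sums over two fibres by the sum of the
    densities; by the retraction inequality the masses
    [push q y * Q y y'] dominate these sums, and replacing the sums by them
    lowers the density further. *)
Lemma action_push q v : (forall x, 0 <= q x) ->
  (action Q L (push q) (push_flow v) <= action Q L q v)%E.
Proof.
move=> q0; rewrite /action lee_wpmul2l ?lee_fin ?invr_ge0//.
pose A x x' := action_density L (q x * Q x x') (q x' * Q x' x) (v x x').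
have A0 x x' : (0 <= A x x')%E by exact: action_density_ge0.
have -> : (\sum_x \sum_x' A x x' = \sum_y \sum_y'
    \sum_(x | T x == y) \sum_(x' | T x' == y') A x x')%E.
  rewrite (partition_big T predT)//=; apply: eq_bigr => y _.
  rewrite [RHS]exchange_big/=; apply: eq_bigr => x _.
  by rewrite (partition_big T predT).
apply: lee_sum => y _; apply: lee_sum => y' _.
have RHS0 : (0 <= \sum_(x | T x == y) \sum_(x' | T x' == y') A x x')%E.
  by apply: sume_ge0 => x _; apply: sume_ge0.
have pq0 z : 0 <= push q z by apply: sumr_ge0.
rewrite /push_flow; case: eqVneq => [->|yy'].
  by rewrite action_density0 ?mulr_ge0// sume_ge0// => x _; exact: sume_ge0.
have [TY _ Tr] := hT.
have [yY|yY] := boolP (y \in Y); last first.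
  rewrite (_ : \sum_(x | T x == y) _ = 0)%R; last exact: (push_notin _ yY).
  by rewrite action_density0 ?mulr_ge0.
have [yY'|yY'] := boolP (y' \in Y); last first.
  rewrite (_ : \sum_(x | T x == y) _ = 0)%R; last first.
    by rewrite big1// => x _; exact: (push_notin _ yY').
  by rewrite action_density0 ?mulr_ge0.
have le1 : \sum_(x | T x == y) \sum_(x' | T x' == y') q x * Q x x' <=
    push q y * Q y y'.
  rewrite mulr_suml; apply: ler_sum => x /eqP Txy.
  by rewrite -mulr_sumr ler_wpM2l// Tr.
have le2 : \sum_(x | T x == y) \sum_(x' | T x' == y') q x' * Q x' x <=
    push q y' * Q y' y.
  rewrite exchange_big/= mulr_suml; apply: ler_sum => x /eqP Txy.
  by rewrite -mulr_sumr ler_wpM2l// Tr// eq_sym.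
apply: le_trans (action_density_antitone hL _ _ le1 _ le2) _.
- by apply: sumr_ge0 => x _; apply: sumr_ge0 => x' _; exact: mulr_ge0.
- by apply: sumr_ge0 => x _; apply: sumr_ge0 => x' _; exact: mulr_ge0.
apply: le_trans (action_density_sum hL _ _ _ _) _.
- by move=> x _; apply: sumr_ge0 => x' _; exact: mulr_ge0.
- by move=> x _; apply: sumr_ge0 => x' _; exact: mulr_ge0.
apply: lee_sum => x _; apply: action_density_sum => // x' _; exact: mulr_ge0.
Qed.

Let integrable_sumr (I : Type) (r : seq I) (P : pred I) (f : I -> R -> R) :
  (forall i, mu.-integrable `[0, 1] (EFin \o f i)) ->
  mu.-integrable `[0, 1] (EFin \o (fun t => \sum_(i <- r | P i) f i t)).
Proof.
move=> fi; rewrite (_ : _ \o _ = (fun t => \sum_(i <- r | P i) (f i t)%:E)%E).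
  by apply: integrable_sum => // i _; exact: fi.
by apply/funext => t /=; rewrite sumEFin.
Qed.

Let Rintegral_sumr (I : Type) (r : seq I) (P : pred I) (f : I -> R -> R) :
  (forall i, mu.-integrable `[0, 1] (EFin \o f i)) ->
  \int[mu]_(t in `[0, 1]) (\sum_(i <- r | P i) f i t) =
  \sum_(i <- r | P i) \int[mu]_(t in `[0, 1]) f i t.
Proof.
move=> fi; elim: r => [|i r ih].
  under eq_Rintegral do rewrite big_nil.
  by rewrite big_nil Rintegral_cst// mul0r.
under eq_Rintegral do rewrite big_cons.
rewrite big_cons; case: (P i) => //.
by rewrite RintegralD// ?ih//; exact: integrable_sumr.
Qed.

Lemma CE1_push nu0 nu1 m V : CE1 nu0 nu1 m V ->
  CE1 (push nu0) (push nu1) (fun t => push (m t)) (fun t => push_flow (V t)).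
Proof.
move=> h; split.
- by move=> t t01; apply: push_prob; exact: (ce_prob h).
- move=> y; apply/subspace_continuousP => t t01.
  rewrite /from_subspace /push.
  elim: (index_enum X) => [|x r ih].
    by under eq_fun do rewrite big_nil; rewrite big_nil; exact: cvg_cst.
  under eq_fun do rewrite big_cons; rewrite big_cons.
  case: (T x == y); last exact: ih.
  apply: cvgD ih.
  by have /subspace_continuousP := ce_continuous h (x := x); exact.
- move=> y y'; apply: integrable_loc_integrable; rewrite /push_flow.
  case: (y == y').
    apply: integrable_within_continuous; apply: continuous_subspaceT.
    by move=> t; exact: cvg_cst.
  by do 2 apply: integrable_sumr => ?; exact: CE1_integrable h.
- by rewrite (ce_start h).
- by rewrite (ce_end h).
- move=> y phi tphi; have sphi := test_function_smooth tphi.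
  have i1 x : mu.-integrable `[0, 1] (EFin \o (fun t => derive1 phi t * m t x)).
    apply: integrable_continuousM;
      first exact: (smooth_continuous (smooth_derive sphi)).
    by apply: integrable_within_continuous; exact: (ce_continuous h).
  have i2 x : mu.-integrable `[0, 1] (EFin \o (fun t => phi t * outflow (V t) x)).
    apply: integrable_continuousM; first exact: (smooth_continuous sphi).
    by apply: integrable_outflow => z z'; exact: CE1_integrable h.
  have -> : \int[mu]_(t in `[0, 1]) (derive1 phi t * push (m t) y) =
      \sum_(x | T x == y) \int[mu]_(t in `[0, 1]) (derive1 phi t * m t x).
    by rewrite -Rintegral_sumr//; apply: eq_Rintegral => t _; rewrite /push mulr_sumr.
  have -> : \int[mu]_(t in `[0, 1]) (phi t * (2^-1 *
        \sum_y' (push_flow (V t) y y' - push_flow (V t) y' y))) =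
      \sum_(x | T x == y) \int[mu]_(t in `[0, 1]) (phi t * outflow (V t) x).
    rewrite -Rintegral_sumr//; apply: eq_Rintegral => t _.
    by rewrite -[2^-1 * _]/(outflow (push_flow (V t)) y) outflow_push mulr_sumr.
  rewrite -sumrN -big_split/= big1// => x _.
  exact: (ce_weak h x tphi).
Qed.

Lemma transport_dist_push_lt nu0 nu1 (r : R) : 0 < r ->
  (transport_dist Q L nu0 nu1 < r%:E)%E ->
  (transport_dist Q L (push nu0) (push nu1) <= r%:E)%E.
Proof.
move=> r0 /(transport_dist_lt hL r0)[m [V [h E]]].
apply: (transport_dist_le (CE1_push h) (ltW r0)).
apply: le_trans (ltW E); apply: ge0_le_integral => //.
- by move=> t _; exact: action_ge0.
- exact: CE1_measurable_action (CE1_push h).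
- exact: CE1_measurable_action h.
- move=> t /=; rewrite in_itv/= => t01; apply: action_push.
  by have [] := ce_prob h t01.
Qed.

End pushforward.

(** * The distance as a continuous metric *)

Section ultralimits.
Context {R : realType}.

(** A cluster point exists by compactness, and an ultrafilter converges to each of
    its cluster points. *)
Lemma ultra_segment_cvg (F : set_system nat) (u : nat -> R) : UltraFilter F ->
  (forall n, 0 <= u n <= 1) -> cvg (u @ F).
Proof.
move=> FU u01.
have u01F : F (u @^-1` `[0, 1]%classic).
  by apply: filterE => n; have := u01 n; rewrite /= in_itv.
have [l [_ cl]] := @segment_compact R 0 1 (u @ F) _ u01F.
apply/cvg_ex; exists l => B nB.
have [//|FnB] := in_ultra_setVsetC (u @^-1` B) FU.
have [r [nBr Br]] : (~` B) `&` B !=set0 by apply: cl.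
by [].
Qed.

(** The equality case of Cauchy-Schwarz: [x ^+ 2 / y] lies above its tangent
    [2 * w * x - y * w ^+ 2], with equality for [x = y * w] only, and the sum of the
    three tangents is at least [w ^+ 2]. Terms with zero denominator have value
    [0] here, which is harmless because their numerator is zero too. *)
Lemma split_energy_equality (s d e a b c w : R) :
  0 <= s -> 0 <= d -> 0 <= e -> s + d + e = 1 ->
  (s = 0 -> a = 0) -> (d = 0 -> b = 0) -> (e = 0 -> c = 0) -> 0 <= w ->
  a ^+ 2 / s + b ^+ 2 / d + c ^+ 2 / e <= w ^+ 2 -> w <= a + b + c ->
  b <= d * w.
Proof.
move=> s0 d0 e0 sde sa db ec w0 energy tri.
have tangent x y : 0 <= y -> (y = 0 -> x = 0) ->
    2 * w * x - y * w ^+ 2 <= x ^+ 2 / y.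
  rewrite le_eqVlt => /predU1P[<- /(_ erefl) ->|y0 _].
    by rewrite invr0 !mulr0 mul0r subrr.
  rewrite ler_pdivlMr// -subr_ge0.
  have -> : x ^+ 2 - (2 * w * x - y * w ^+ 2) * y = (x - y * w) ^+ 2 by ring.
  exact: sqr_ge0.
have ta := tangent _ _ s0 sa; have tc := tangent _ _ e0 ec.
have wabc : w * w <= w * (a + b + c) by rewrite ler_wpM2l.
have hb : b ^+ 2 / d <= 2 * w * b - d * w ^+ 2.
  have sdew : s * w ^+ 2 + d * w ^+ 2 + e * w ^+ 2 = w ^+ 2.
    by rewrite -!mulrDl sde mul1r.
  by move: (a ^+ 2 / s) (b ^+ 2 / d) (c ^+ 2 / e) energy ta tc => A B C; nra.
move: d0; rewrite le_eqVlt => /predU1P[d0|d0].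
  by rewrite db -?d0// mul0r.
move: hb; rewrite ler_pdivrMr// -subr_ge0.
have -> : (2 * w * b - d * w ^+ 2) * d - b ^+ 2 = - (b - d * w) ^+ 2 by ring.
rewrite oppr_ge0 => h; have /eqP : (b - d * w) ^+ 2 = 0.
  by apply/eqP; rewrite eq_le h sqr_ge0.
by rewrite sqrf_eq0 subr_eq0 => /eqP ->.
Qed.

Lemma ge0_integral_itv_split (a b c : R) (f : R -> \bar R) : a <= b -> b <= c ->
  measurable_fun (`[a, c]%classic : set R) f -> (forall t, 0 <= f t)%E ->
  (\int[@lebesgue_measure R]_(t in `[a, c]) f t =
   \int[@lebesgue_measure R]_(t in `[a, b]) f t +
   \int[@lebesgue_measure R]_(t in `[b, c]) f t)%E.
Proof.
move=> ab bc mf f0.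
have acE : `[a, c]%classic = `[a, b]%classic `|` `]b, c]%classic :> set R.
  by rewrite -itv_bndbnd_setU// bnd_simp.
have mf2 : measurable_fun (`]b, c]%classic : set R) f.
  apply: measurable_funS mf => //; rewrite acE; exact: subsetUr.
rewrite acE ge0_integral_setU//.
- by congr (_ + _)%E; rewrite integral_itv_obnd_cbnd.
- by rewrite -acE.
- rewrite disj_set2E; apply/eqP/seteqP; split => // t [] /=.
  by rewrite !in_itv/= => /andP[_ +] /andP[+ _]; case: ltgtP.
Qed.

End ultralimits.

Section metric.
Context {R : realType} {X : finType} (Q : X -> X -> R) (p : X -> R)
  (L : R * R -> R).
Hypotheses (hQ : markov_triple Q p) (hL : admissible_mean L).
Notation mu := (@lebesgue_measure R).
Implicit Types (nu : X -> R).

Let Q_ge0 : forall x y, 0 <= Q x y := rate_ge0 hQ.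

Local Notation W := (transport_dist Q L).

Definition dist nu0 nu1 : R := fine (W nu0 nu1).

Lemma prob_dist_le1 nu0 nu1 x : prob nu0 -> prob nu1 -> `|nu1 x - nu0 x| <= 1.
Proof.
move=> p0 p1; have := prob_le1 x p0; have := prob_le1 x p1.
by have := proj1 p0 x; have := proj1 p1 x; rewrite ler_norml; lra.
Qed.

Lemma distE nu0 nu1 : prob nu0 -> prob nu1 -> W nu0 nu1 = (dist nu0 nu1)%:E.
Proof.
move=> p0 p1; rewrite /dist fineK// ge0_fin_numE; last exact: transport_dist_ge0.
have [C _ HC] := transport_dist_holder hQ hL.
have h1 : 0 < (1 : R) <= 1 by rewrite ltr01 lexx.
by rewrite (le_lt_trans (HC _ _ _ p0 p1 h1 _)) ?ltry// => x; exact: prob_dist_le1.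
Qed.

Lemma dist_ge0 nu0 nu1 : 0 <= dist nu0 nu1.
Proof. by rewrite fine_ge0// transport_dist_ge0. Qed.

Lemma dist_holder : exists2 C : R, 0 <= C & forall nu0 nu1 d,
  prob nu0 -> prob nu1 -> 0 < d <= 1 -> (forall x, `|nu1 x - nu0 x| <= d) ->
  dist nu0 nu1 <= Num.sqrt (C * d).
Proof.
have [C C0 HC] := transport_dist_holder hQ hL; exists C => //.
move=> nu0 nu1 d p0 p1 d01 nud; have := HC _ _ _ p0 p1 d01 nud.
by rewrite distE// lee_fin.
Qed.

Lemma dist_triangle nu0 nu1 nu2 : prob nu0 -> prob nu1 -> prob nu2 ->
  dist nu0 nu2 <= dist nu0 nu1 + dist nu1 nu2.
Proof.
move=> p0 p1 p2; apply/ler_addgt0Pr => e e0.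
have e2 : 0 < e / 2 by rewrite divr_gt0.
have := @transport_dist_triangle_lt _ _ Q L hL Q_ge0 nu0 nu1 nu2
  (dist nu0 nu1 + e / 2) (dist nu1 nu2 + e / 2).
rewrite !distE// !lte_fin lee_fin addrACA -splitr; apply.
- by apply: ltr_pwDr => //; exact: dist_ge0.
- by apply: ltr_pwDr => //; exact: dist_ge0.
- by rewrite ltrDl.
- by rewrite ltrDl.
Qed.

(** The piece of the curve between the times [a] and [b], run in unit time, has
    energy [b - a] times the action spent between these times. For [a = b] the
    left-hand side is [0], as division by zero yields zero. *)
Lemma dist_subcurve nu0 nu1 m V a b : CE1 nu0 nu1 m V ->
  0 <= a -> a <= b -> b <= 1 ->
  ((dist (m a) (m b) ^+ 2 / (b - a))%:E <=
   \int[mu]_(t in `[a, b]) action Q L (m t) (V t))%E.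
Proof.
move=> h a0 ab b1.
have int0 : (0 <= \int[mu]_(t in `[a, b]) action Q L (m t) (V t))%E.
  by apply: integral_ge0 => t _; exact: action_ge0.
move: (ab); rewrite le_eqVlt => /predU1P[->|ab'].
  rewrite subrr invr0 mulr0; apply: integral_ge0 => t _; exact: action_ge0.
have c0 : 0 < b - a by rewrite subr_gt0.
have abE : a + (b - a) = b by rewrite addrC subrK.
have a01 : 0 <= a <= 1 by rewrite a0 (le_trans ab).
have b01 : 0 <= a + (b - a) <= 1 by rewrite abE b1 (le_trans a0).
have h' := CE1_affine (lt0r_neq0 c0) a01 b01 h.
have E' := energy_affine hL Q_ge0 (lt0r_neq0 c0) a01 b01 h.
rewrite abE in h' E'.
rewrite min_l// max_r// gtr0_norm// in E'.
move: int0 E'; case: (integral _ _ _) => [I|_ _|//]; last exact: leey.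
rewrite lee_fin => I0 E'.
have cI : 0 <= (b - a) * I by rewrite mulr_ge0 ?(ltW c0).
have : (W (m a) (m b) <= (Num.sqrt ((b - a) * I))%:E)%E.
  apply: (transport_dist_le h'); first exact: sqrtr_ge0.
  by rewrite E' sqr_sqrtr// -EFinM.
have b01' : 0 <= b <= 1 by rewrite (le_trans a0).
rewrite (distE (ce_prob h a01) (ce_prob h b01')).
rewrite !lee_fin ler_pdivrMr// [I * _]mulrC => dI.
by rewrite -(sqr_sqrtr cI) lerXn2r ?nnegrE ?dist_ge0 ?sqrtr_ge0.
Qed.

(** Run a nearly optimal curve backwards; the action is even in the flux. *)
Lemma dist_sym_le nu0 nu1 : prob nu0 -> prob nu1 -> dist nu1 nu0 <= dist nu0 nu1.
Proof.
move=> p0 p1; apply/ler_addgt0Pr => e e0.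
have r0 : 0 < dist nu0 nu1 + e by rewrite ltr_pwDr ?dist_ge0.
have [|m [V [h E]]] := transport_dist_lt (L := L) (Q := Q) hL
  (nu0 := nu0) (nu1 := nu1) r0.
  by rewrite distE// lte_fin ltrDl.
have c0 : - 1 != 0 :> R by rewrite oppr_eq0 oner_eq0.
have a01 : 0 <= (1 : R) <= 1 by rewrite ler01 lexx.
have b01 : 0 <= (1 : R) + (- 1) <= 1 by rewrite subrr ler01 lexx.
have h' := CE1_affine c0 a01 b01 h.
have E' := energy_affine hL Q_ge0 c0 a01 b01 h.
rewrite subrr (ce_start h) (ce_end h) in h'.
rewrite subrr min_r ?ler01// max_l ?ler01// normrN1 mul1e in E'.
have := @transport_dist_le _ _ Q L _ _ _ _ _ h' (ltW r0).
by rewrite E' distE// lee_fin; apply; exact: ltW.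
Qed.

Lemma dist_sym nu0 nu1 : prob nu0 -> prob nu1 -> dist nu1 nu0 = dist nu0 nu1.
Proof. by move=> p0 p1; apply/eqP; rewrite eq_le !dist_sym_le. Qed.

Lemma dist_small e : 0 < e -> exists2 d, 0 < d & forall nu0 nu1,
  prob nu0 -> prob nu1 -> (forall x, `|nu1 x - nu0 x| <= d) -> dist nu0 nu1 <= e.
Proof.
move=> e0; have [C C0 HC] := dist_holder.
have C1 : 0 < C + 1 by rewrite ltr_pwDr.
pose d := Num.min 1 (e ^+ 2 / (C + 1)).
have d0 : 0 < d by rewrite lt_min ltr01 divr_gt0 ?exprn_gt0.
exists d => // nu0 nu1 p0 p1 nud.
have d01 : 0 < d <= 1 by rewrite d0 ge_min lexx.
apply: (le_trans (HC _ _ d p0 p1 d01 nud)).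
rewrite -(ger0_norm (ltW e0)) -sqrtr_sqr ler_wsqrtr//.
have : d <= e ^+ 2 / (C + 1) by rewrite ge_min lexx orbT.
rewrite ler_pdivlMr// => /(le_trans _); apply.
by rewrite mulrC ler_wpM2l ?(ltW d0)// lerDl.
Qed.

Lemma dist_self nu : prob nu -> dist nu nu = 0.
Proof.
move=> pn; apply/eqP; rewrite eq_le dist_ge0 andbT.
apply/ler_addgt0Pr => e e0; rewrite add0r.
have [d d0] := dist_small e0; apply => // x.
by rewrite subrr normr0 ltW.
Qed.

(** Continuity of the distance for pointwise convergence, from [dist_small] and the
    triangle inequality. *)
Lemma dist_cvg (F : set_system nat) (q q' : nat -> X -> R) nu nu' :
  ProperFilter F ->
  (forall n, prob (q n)) -> (forall n, prob (q' n)) -> prob nu -> prob nu' ->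
  (forall x, q n x @[n --> F] --> nu x) -> (forall x, q' n x @[n --> F] --> nu' x) ->
  dist (q n) (q' n) @[n --> F] --> dist nu nu'.
Proof.
move=> FF pq pq' pn pn' qnu q'nu; apply/cvgrPdist_le => e e0.
have e2 : 0 < e / 2 by rewrite divr_gt0.
have [d d0 Hd] := dist_small e2.
have near_nu (r : nat -> X -> R) l : (forall x, r n x @[n --> F] --> l x) ->
    \forall n \near F, forall x, `|l x - r n x| <= d.
  move=> rl; suff : \forall n \near F, forall x, x \in enum X -> `|l x - r n x| <= d.
    by apply: filterS => n H x; apply: H; rewrite mem_enum.
  elim: (enum X) => [|y s ih]; first exact: nearW.
  have /cvgrPdist_le/(_ _ d0) hy := rl y.
  near=> n => x; rewrite inE => /predU1P[->|xs].
    by near: n.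
  by move: x xs; near: n.
have := near_nu _ _ qnu; have := near_nu _ _ q'nu => h' h.
near=> n.
have hq : dist (q n) nu <= e / 2 by apply: Hd => //; near: n.
have hq' : dist (q' n) nu' <= e / 2 by apply: Hd => //; near: n.
have t1 := dist_triangle (pq n) pn (pq' n).
have t2 := dist_triangle pn pn' (pq' n).
have t3 := dist_triangle pn (pq n) pn'.
have t4 := dist_triangle (pq n) (pq' n) pn'.
have s1 := dist_sym (pq n) pn; have s2 := dist_sym (pq' n) pn'.
rewrite ler_norml; lra.
Unshelve. all: by end_near. Qed.

End metric.

(** * Geodesics *)

Section geodesics.
Context {R : realType} {X : finType} (Q : X -> X -> R) (p : X -> R)
  (L : R * R -> R).
Hypotheses (hQ : markov_triple Q p) (hL : admissible_mean L).
Notation mu := (@lebesgue_measure R).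
Implicit Types (nu : X -> R).

Local Notation dist := (dist Q L).

Let Q_ge0 : forall x y, 0 <= Q x y := rate_ge0 hQ.

Let cvg_sumr (F : set_system nat) (q : nat -> X -> R) nu : Filter F ->
  (forall x, q n x @[n --> F] --> nu x) ->
  \sum_x q n x @[n --> F] --> \sum_x nu x.
Proof.
move=> FF qnu; elim: (index_enum X) => [|x r ih].
  by under eq_fun do rewrite big_nil; rewrite big_nil; exact: cvg_cst.
under eq_fun do rewrite big_cons; rewrite big_cons.
by apply: cvgD ih; exact: qnu.
Qed.

Lemma three_piece_energy nu0 nu1 m V (r s t : R) : CE1 nu0 nu1 m V ->
  (\int[mu]_(t in `[0%R, 1%R]) action Q L (m t) (V t) < r%:E)%E ->
  0 <= s -> s <= t -> t <= 1 ->
  dist (m 0) (m s) ^+ 2 / s + dist (m s) (m t) ^+ 2 / (t - s) +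
    dist (m t) (m 1) ^+ 2 / (1 - t) <= r.
Proof.
move=> h E s0 st t1.
have mA := CE1_measurable_action hL Q_ge0 h.
have A0 u : (0 <= action Q L (m u) (V u))%E by exact: action_ge0.
have s1 := le_trans st t1.
have mA' : measurable_fun (`[s, 1]%classic : set R) (fun t => action Q L (m t) (V t)).
  by apply: measurable_funS mA => //; apply: subset_itvr; rewrite bnd_simp.
rewrite -lee_fin !EFinD; apply: le_trans (ltW E).
rewrite (ge0_integral_itv_split s0 s1 mA A0) (ge0_integral_itv_split st t1 mA' A0).
rewrite addeA; apply: leeD; first apply: leeD.
- have := dist_subcurve hQ hL h (lexx 0) s0 s1; by rewrite subr0.
- exact: (dist_subcurve hQ hL h s0 st t1).
- exact: (dist_subcurve hQ hL h (le_trans s0 st) t1 (lexx 1)).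
Qed.

(** Pointwise limits along an ultrafilter exist for all times simultaneously and
    need no equicontinuity; the limit inherits the energy inequality by continuity
    of the distance, and the Cauchy-Schwarz equality case fixes its speed. *)
Lemma short_curve_exists nu0 nu1 : prob nu0 -> prob nu1 ->
  exists gamma : R -> X -> R,
    [/\ gamma 0 = nu0, gamma 1 = nu1, forall t, 0 <= t <= 1 -> prob (gamma t)
      & forall s t, 0 <= s -> s <= t -> t <= 1 ->
          dist (gamma s) (gamma t) <= (t - s) * dist nu0 nu1].
Proof.
move=> p0 p1; set w := dist nu0 nu1.
have w0 : 0 <= w by exact: dist_ge0.
pose r n : R := w + n.+1%:R^-1.
have /choice[mV HmV] n : exists mV : (R -> X -> R) * (R -> X -> X -> R),
    CE1 nu0 nu1 mV.1 mV.2 /\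
    (\int[mu]_(t in `[0%R, 1%R]) action Q L (mV.1 t) (mV.2 t) < (r n ^+ 2)%:E)%E.
  have n0 : 0 < n.+1%:R^-1 :> R by rewrite invr_gt0.
  have rn : 0 < r n by rewrite ltr_pwDr.
  have [|m [V [h E]]] := transport_dist_lt (Q := Q) hL (nu0 := nu0) (nu1 := nu1) rn.
    by rewrite (distE hQ)// lte_fin ltrDl.
  by exists (m, V).
pose m n := (mV n).1.
have hm n : CE1 nu0 nu1 (m n) (mV n).2 by have [] := HmV n.
have [F [FU ooF]] := ultraFilterLemma (eventually_filter).
have FF : ProperFilter F by exact: ultra_proper.
pose gamma t x := lim (m n t x @[n --> F]).
have cvg_gamma t x : 0 <= t <= 1 -> m n t x @[n --> F] --> gamma t x.
  move=> t01; apply: ultra_segment_cvg => n.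
  have pm := ce_prob (hm n) t01; rewrite prob_le1// andbT.
  by case: pm.
have pgamma t : 0 <= t <= 1 -> prob (gamma t).
  move=> t01; have pm n := ce_prob (hm n) t01; split.
    move=> x; apply: limr_ge;
      first by apply/cvg_ex; exists (gamma t x); exact: cvg_gamma.
    by apply: nearW => n; case: (pm n).
  have c1 : (fun n => \sum_x m n t x) = cst 1.
    by apply/funext => n; exact: (proj2 (pm n)).
  have c2 : (fun n => \sum_x m n t x) @ F --> \sum_x gamma t x.
    by apply: cvg_sumr => x; exact: cvg_gamma.
  by have <- := cvg_lim (@Rhausdorff R) c2; rewrite c1 lim_cst.
have I0 : 0 <= (0 : R) <= 1 by rewrite lexx ler01.
have I1 : 0 <= (1 : R) <= 1 by rewrite lexx ler01.
have gamma0 : gamma 0 = nu0.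
  apply/funext => x; rewrite /gamma; under eq_fun do rewrite (ce_start (hm _)).
  exact: lim_cst.
have gamma1 : gamma 1 = nu1.
  apply/funext => x; rewrite /gamma; under eq_fun do rewrite (ce_end (hm _)).
  exact: lim_cst.
exists gamma; split => // s t s0 st t1.
have s01 : 0 <= s <= 1 by rewrite s0 (le_trans st).
have t01 : 0 <= t <= 1 by rewrite t1 (le_trans s0).
have cd u v : 0 <= u <= 1 -> 0 <= v <= 1 ->
    dist (m n u) (m n v) @[n --> F] --> dist (gamma u) (gamma v).
  move=> u01 v01; apply: (dist_cvg hQ hL) => [n|n|||x|x].
  - exact: (ce_prob (hm n)).
  - exact: (ce_prob (hm n)).
  - exact: pgamma.
  - exact: pgamma.
  - exact: cvg_gamma.
  - exact: cvg_gamma.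
have cdq u v (k : R) : 0 <= u <= 1 -> 0 <= v <= 1 ->
    dist (m n u) (m n v) ^+ 2 / k @[n --> F] -->
    dist (gamma u) (gamma v) ^+ 2 / k.
  by move=> u01 v01; apply: cvgM; [apply: cvgM; exact: cd|exact: cvg_cst].
have cr : r n ^+ 2 @[n --> F] --> w ^+ 2.
  have ch : r n @[n --> F] --> w.
    rewrite -[X in _ --> X]addr0; apply: cvgD; first exact: cvg_cst.
    by move=> A /(@cvg_harmonic R); exact: ooF.
  by apply: cvgM.
have energy : dist (gamma 0) (gamma s) ^+ 2 / s +
    dist (gamma s) (gamma t) ^+ 2 / (t - s) +
    dist (gamma t) (gamma 1) ^+ 2 / (1 - t) <= w ^+ 2.
  apply: ler_cvg_to cr _; first by apply: cvgD; [apply: cvgD|]; exact: cdq.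
  apply: nearW => n; have [h E] := HmV n.
  exact: (three_piece_energy h E).
apply: (split_energy_equality s0 _ _ _ _ _ _ w0 energy).
- by rewrite subr_ge0.
- by rewrite subr_ge0.
- by ring.
- by move=> ->; rewrite (dist_self hQ hL)//;
    exact: pgamma.
- by move=> /eqP; rewrite subr_eq0 => /eqP ->; rewrite (dist_self hQ hL)//;
    exact: pgamma.
- by move=> /eqP; rewrite subr_eq0 => /eqP <-; rewrite (dist_self hQ hL)//;
    exact: pgamma.
- have := dist_triangle hQ hL (pgamma _ I0) (pgamma _ s01) (pgamma _ I1).
  have := dist_triangle hQ hL (pgamma _ s01) (pgamma _ t01) (pgamma _ I1).
  rewrite gamma0 gamma1 -/w; lra.
Qed.

(** If one of the three pieces of the curve were strictly shorter than its share,
    the endpoints would be too close by the triangle inequality. *)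
Lemma short_curve_geodesic gamma : (forall t, 0 <= t <= 1 -> prob (gamma t)) ->
  (forall s t, 0 <= s -> s <= t -> t <= 1 ->
     dist (gamma s) (gamma t) <= (t - s) * dist (gamma 0) (gamma 1)) ->
  geodesic Q L gamma.
Proof.
move=> pg short; split => // s t s01 t01.
have I0 : 0 <= (0 : R) <= 1 by rewrite lexx ler01.
have I1 : 0 <= (1 : R) <= 1 by rewrite lexx ler01.
rewrite (distE hQ hL (pg _ s01) (pg _ t01)) (distE hQ hL (pg _ I0) (pg _ I1)) -EFinM.
congr EFin.
wlog st : s t s01 t01 / s <= t.
  move=> H; case: (leP s t) => [|/ltW] st; first exact: H.
  by rewrite (dist_sym hQ hL (pg _ t01) (pg _ s01)) distrC; exact: H.
case/andP: (s01) => s0 s1; case/andP: (t01) => t0 t1.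
rewrite ger0_norm ?subr_ge0//; apply/eqP; rewrite eq_le short//=.
have := dist_triangle hQ hL (pg _ I0) (pg _ s01) (pg _ I1).
have := dist_triangle hQ hL (pg _ s01) (pg _ t01) (pg _ I1).
have := short 0 s (lexx 0) s0 s1; have := short t 1 t0 t1 (lexx 1).
by rewrite subr0 !mulrBl mul1r; lra.
Qed.

End geodesics.

Theorem theorem4p11 (R : realType) (X : finType) (Q : X -> X -> R)
    (p : X -> R) (L : R * R -> R) (Y : {set X}) (mu0 mu1 : X -> R)
    (hQ : markov_triple Q p) (hL : admissible_mean L)
    (hY : retraction_property Q Y)
    (hmu0 : prob mu0) (hmu1 : prob mu1)
    (hsupp0 : {subset support mu0 <= Y}) (hsupp1 : {subset support mu1 <= Y}) :
  exists mu : R -> X -> R,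
    [/\ geodesic Q L mu, mu 0 = mu0, mu 1 = mu1
      & forall t : R, 0 <= t <= 1 -> {subset support (mu t) <= Y}].
Proof.
have [_ [T hT]] := hY; have Q_ge0 := rate_ge0 hQ.
have [gamma [g0 g1 pg short]] := short_curve_exists hQ hL hmu0 hmu1.
have p0 : push T (gamma 0) = mu0 by rewrite g0 (push_supported hT).
have p1 : push T (gamma 1) = mu1 by rewrite g1 (push_supported hT).
have pp t : 0 <= t <= 1 -> prob (push T (gamma t)).
  by move=> t01; apply: push_prob; exact: pg.
exists (fun t => push T (gamma t)); split => // [|t t01 x].
- apply: (short_curve_geodesic hQ hL) => // s t s0 st t1.
  have s01 : 0 <= s <= 1 by rewrite s0 (le_trans st).
  have t01 : 0 <= t <= 1 by rewrite t1 (le_trans s0).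
  rewrite p0 p1; apply: le_trans (short s t s0 st t1).
  apply/ler_addgt0Pr => e e0.
  have := @transport_dist_push_lt _ _ Q L Y T hL Q_ge0 hT (gamma s) (gamma t)
    (dist Q L (gamma s) (gamma t) + e).
  rewrite (distE hQ hL (pg _ s01) (pg _ t01)) (distE hQ hL (pp _ s01) (pp _ t01)).
  rewrite lee_fin lte_fin ltrDl; apply => //.
  by rewrite ltr_pwDr// dist_ge0.
- by apply: contraLR => xY; rewrite inE negbK (push_notin hT _ xY).
Qed.
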